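(* Let $H$ be a digraph with $h$ vertices, $m$ arcs, maximum out-degree $\Delta$, and exactly $k_1$ vertices of in-degree zero, such that $\delta(H)\ge 1$, and set $q=\Delta\cdot\max\{h/2,m\}$. Then every $(k_1+m+1)$-connected semicomplete digraph $D$ with $\delta^+(D)\ge 10^7q^4$ is $H$-linked.
   Context: All digraphs are finite and simple. $\delta(H)=\min\{d^+_H(v)+d^-_H(v): v\in V(H)\}$, so $\delta(H)\ge1$ means $H$ has no isolated vertices. A semicomplete digraph is a digraph in which every pair of distinct vertices is joined by at least one arc. A digraph is $t$-connected if it has at least $t+1$ vertices and, for every set $S$ of at most $t-1$ vertices and any distinct $x,y\notin S$, there is a directed $(x,y)$-path in $D-S$. $\delta^+(D)$ is the minimum out-degree of $D$. An $H$-subdivision $(f,g)$ in $D$ consists of an injective map $f:V(H)\to V(D)$ and a map $g$ assigning to every arc $uv\in A(H)$ a directed path $g(uv)$ in $D$ from $f(u)$ to $f(v)$, such that the paths assigned to distinct arcs are internally vertex-disjoint and have no internal vertices in $f(V(H))$. $D$ is $H$-linked if every injective map $f:V(H)\to V(D)$ can be extended to an $H$-subdivision $(f,g)$ in $D$. *)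

(* Defs.v *)
(* Digraphs on a finType V are irreflexive boolean relations E : rel V
   (E x y = there is an arc x -> y); "simple" = no loops, no parallel arcs. *)
From HB Require Import structures.
From mathcomp Require Import all_boot all_order all_algebra.
Set Implicit Arguments. Unset Strict Implicit. Unset Printing Implicit Defensive.
Import Order.TTheory GRing.Theory Num.Theory.

Section Digraphs.
Variable V : finType.
Implicit Types (E : rel V).

Definition outdeg E x : nat := #|[set y | E x y]|.
Definition indeg E x : nat := #|[set y | E y x]|.
Definition narcs E : nat := #|[set p : V * V | E p.1 p.2]|.
Definition maxoutdeg E : nat := \max_(x : V) outdeg E x.
Definition nsources E : nat := #|[set x | indeg E x == 0]|.

Definition semicomplete E : Prop := forall x y : V, x != y -> E x y || E y x.

Definition dipath E (a : V) (s : seq V) (b : V) : bool :=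
  path E a (rcons s b) && uniq (a :: rcons s b).

Definition t_connected E (t : nat) : Prop :=
  t.+1 <= #|V| /\
  forall S : {set V}, #|S| < t ->
    forall x y : V, x \notin S -> y \notin S -> x != y ->
      exists s : seq V, dipath E x s y && all (fun z => z \notin S) s.
End Digraphs.

Definition is_subdivision (VH VD : finType) (EH : rel VH) (ED : rel VD)
    (f : VH -> VD) (g : VH -> VH -> seq VD) : Prop :=
  [/\ injective f,
      (forall u v, EH u v -> dipath ED (f u) (g u v) (f v)),
      (forall u v u' v', EH u v -> EH u' v' -> (u, v) != (u', v') ->
          [disjoint g u v & g u' v'])
    & (forall u v w, EH u v -> f w \notin g u v)].

Definition H_linked (VH VD : finType) (EH : rel VH) (ED : rel VD) : Prop :=
  forall f : VH -> VD, injective f -> exists g, is_subdivision EH ED f g.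

Definition qparam (VH : finType) (EH : rel VH) : rat :=
  ((maxoutdeg EH)%:R * Num.max (#|VH|%:R / 2) (narcs EH)%:R)%R.

(* Main.v *)
(** Contract the arcs of [H] to tokens and let [U] be a small set of vertices of
    large in-degree of [D - f(V(H))]: since out-degrees are large, every vertex
    reaches every vertex of [U] by a path of length at most three avoiding any
    small set.  Systems of disjoint paths from [U] to the heads of the arcs of [H]
    are permutations moving every token; take one moving as few vertices as
    possible.  Walks in its residual digraph, weighted by the change of the number
    of moved vertices, have no negative cycle, so their distances from a token give
    a potential, and a vertex dominates every vertex lying at least two levels
    below it.  An arc of [H] must leave its tail through a vertex off the paths.
    When nearly all out-neighbours of the tail are on the paths, the extra unit
    of connectivity yields a residual cycle that frees one of them and stays
    within a narrow window of levels; greedy interval scheduling makes all the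
    windows used disjoint, so all these cycles can be switched at once.  Finally
    an exit at a high level dominates all of [U] off the paths, while the short
    paths from an exit at a low level meet only the few path vertices of low
    level, so each exit can be joined to the start of its path. *)
Require Import Defs.
From mathcomp Require Import all_boot all_order all_algebra.
From mathcomp Require Import perm zify.
Set Implicit Arguments. Unset Strict Implicit. Unset Printing Implicit Defensive.
Import Order.TTheory GRing.Theory Num.Theory.

(** * Potentials of weighted digraphs *)

Section WalkWeights.
Variables (N : finType) (E : rel N) (w : N -> N -> int).

Fixpoint walk_weight (x : N) (s : seq N) : int :=
  if s is y :: s' then (w x y + walk_weight y s')%R else 0%R.

Lemma walk_weight_cat x s1 s2 :
  walk_weight x (s1 ++ s2) = (walk_weight x s1 + walk_weight (last x s1) s2)%R.
Proof.
by elim: s1 x => [|y s1 IH] x /=; rewrite ?add0r // IH addrA.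
Qed.

Lemma walk_weight_cycle x s : uniq (x :: s) ->
  walk_weight x (rcons s x) = (\sum_(i <- x :: s) w i (next (x :: s) i))%R.
Proof.
have gen y0 y p : uniq (y :: p) ->
    walk_weight y (rcons p y0) = (\sum_(i <- y :: p) w i (next_at i y0 y p))%R.
  elim: p y => [|z p IH] y /=; first by rewrite big_seq1 eqxx addr0.
  rewrite inE negb_or -andbA => /and4P[yz yp zp up].
  rewrite big_cons eqxx IH /= ?zp //; congr (_ + _)%R.
  rewrite big_seq [RHS]big_seq; apply: eq_bigr => i iz.
  case: (eqVneq i y) => // iy; move: iz; rewrite iy inE (negPf yz) (negPf yp) //.
exact: gen.
Qed.

(** [pi j] is the least weight of a simple path from [r] to [j]. Extending such a path to a vertex
    it already visits closes a cycle of nonnegative weight, which can be cut off; hence the triangle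
    inequality. *)
Lemma shortest_walk_potential (r : N) :
  (forall j, connect E r j) ->
  (forall x s, uniq (x :: s) -> cycle E (x :: s) ->
     (0 <= walk_weight x (rcons s x))%R) ->
  exists pi : N -> int,
    [/\ pi r = 0%R,
        forall i j, E i j -> (pi j <= pi i + w i j)%R
      & forall j, exists2 s,
          path (fun x y => E x y && (pi y == pi x + w x y)%R) r s & last r s = j].
Proof.
move=> conn cyc.
pose ok j (s : #|N|.-bseq N) := [&& path E r s, uniq (r :: s) & last r s == j].
have sz s : uniq (r :: s) -> size s <= #|N|.
  by move=> us; have := max_card (mem (r :: s)); rewrite (card_uniqP us) /=; lia.
(* Simple paths have length at most [#|N|], so they live in a finite type and a minimum exists. *)
have exs j : {s : #|N|.-bseq N | ok j s}.
  apply: sigW; have /connectP[p pE ej] := conn j.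
  case/shortenP: pE ej => p' p'E up' _ ej.
  by exists (Bseq (sz _ up')); rewrite /ok p'E up' -ej eqxx.
pose m j := [arg min_(s < sval (exs j) | ok j s) walk_weight r s]%O.
have mP j : ok j (m j) /\ forall s, ok j s -> (walk_weight r (m j) <= walk_weight r s)%R.
  by rewrite /m; case: arg_minP => [|s oks mins]; [exact: (svalP (exs j)) | split].
pose pi j := walk_weight r (m j).
have pi_le s : path E r s -> uniq (r :: s) -> (pi (last r s) <= walk_weight r s)%R.
  move=> sE us; have := (mP (last r s)).2 (Bseq (sz _ us)); apply.
  by apply/and3P; split=> //=.
have pir : pi r = 0%R.
  have := (mP r).1; rewrite /ok /pi.
  case: (m r : seq N) => [|y s] //= /and3P[_ /andP[rs _] /eqP lr].
  by move: rs; rewrite -{1}lr mem_last.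
have tri i j : E i j -> (pi j <= pi i + w i j)%R.
  move=> ij; have := (mP i).1; rewrite /ok {2}/pi.
  move: (m i : seq N) => s /and3P[sE us /eqP ls].
  have [js|js] := boolP (j \in r :: s); last first.
    have := pi_le (rcons s j); rewrite last_rcons -cats1 walk_weight_cat ls /= addr0.
    apply; first by rewrite cat_path sE /= ls ij.
    by have : uniq ((r :: s) ++ [:: j]) by rewrite cat_uniq us /= orbF js.
  case/splitPl: js sE us ls => p1 p2 lp1.
  rewrite cat_path last_cat lp1 walk_weight_cat lp1 => /andP[p1E p2E] us lp2.
  have p1j := pi_le p1 p1E; rewrite lp1 in p1j.
  have up1 : uniq (r :: p1) by move: us; rewrite -cat_cons cat_uniq => /and3P[].
  have up2 : uniq (j :: p2).
    move: us; rewrite -cat_cons lastI lp1 -cats1 -catA cat_uniq => /and3P[_ _].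
    by rewrite cat1s.
  have := cyc j p2 up2; rewrite /= rcons_path p2E lp2 ij -cats1 walk_weight_cat lp2 /=.
  by move=> /(_ isT); have := p1j up1; lia.
have pi_walk p x : path E x p -> (pi (last x p) <= pi x + walk_weight x p)%R.
  elim: p x => [|y p IH] x /=; first by rewrite addr0.
  by move=> /andP[/tri xy /IH]; lia.
(* A walk whose total weight equals its rise in potential has no slack in any step. *)
have tight_walk s x : path E x s -> (pi (last x s) = pi x + walk_weight x s)%R ->
    path (fun x y => E x y && (pi y == pi x + w x y)%R) x s.
  elim: s x => [|y s IH] x //= /andP[xy sE] ws.
  have yt := pi_walk _ _ sE; have xt := tri _ _ xy.
  by rewrite xy IH //; [rewrite andbT; apply/eqP|]; lia.
exists pi; split=> // j.
have := (mP j).1; rewrite /ok; have := erefl (pi j); rewrite {1}/pi.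
move: (m j : seq N) => s ws /and3P[sE _ /eqP ls]; exists s => //.
by apply: tight_walk; rewrite // ls pir add0r ws.
Qed.
End WalkWeights.

(** * Interval scheduling and sinks *)

(** Greedy: settle the pair with the smallest right end [r v], then strike from the other sets the
    at most [d] intervals containing [r v]. What survives lies to its right, and no set loses more
    than the drop of [d * #|E|]. *)
Lemma disjoint_interval_choice (R V : finType) (l r : V -> int) (d : nat)
    (Z : {set V}) (v0 : V) (E : {set R}) (C : R -> {set V}) :
  0 < d ->
  (forall v, v \in Z -> (l v <= r v)%R) ->
  (forall t, #|[set v in Z | ((l v <= t) && (t <= r v))%R]| <= d) ->
  (forall e, e \in E -> C e \subset Z) ->
  (forall e, e \in E -> d * #|E| <= #|C e|) ->
  exists a : R -> V, (forall e, e \in E -> a e \in C e) /\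
    {in E &, forall e e', e != e' -> ((r (a e) < l (a e')) || (r (a e') < l (a e)))%R}.
Proof.
move=> d0 lr depth.
have [n] := ubnP #|E|; elim: n E C => // n IH E C.
rewrite ltnS => En CZ Cd.
have [->|/set0Pn[e1 e1E]] := eqVneq E set0.
  by exists (fun=> v0); split=> [e|e e']; rewrite inE.
have E0 : 0 < #|E| by apply/card_gt0P; exists e1.
have [v1 v1C] : exists v, v \in C e1.
  by apply/card_gt0P; apply: leq_trans (Cd _ e1E); rewrite muln_gt0 d0.
pose P (p : R * V) := (p.1 \in E) && (p.2 \in C p.1).
have P1 : P (e1, v1) by rewrite /P /= e1E.
case: (arg_minP (fun p : R * V => r p.2) P1) => -[e v] /andP[/= eE vC] rmin.
pose C' f := C f :\: [set x in Z | ((l x <= r v) && (r v <= r x))%R].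
have Ee : #|E :\ e| < #|E| by rewrite [#|E|](cardsD1 e) eE.
have [] := IH (E :\ e) C' (leq_trans Ee En).
- move=> f /setD1P[_ fE]; apply: subset_trans (CZ f fE); exact: subsetDl.
- move=> f /setD1P[_ fE]; rewrite [#|C' f|]cardsD.
  have := Cd f fE; rewrite [#|E|](cardsD1 e) eE mulnDr muln1 => Cf.
  have := subset_leq_card (subsetIr (C f) [set x in Z | ((l x <= r v) && (r v <= r x))%R]).
  have := depth (r v). lia.
move=> a [aC' adis].
have sep f : f \in E -> f != e -> (r v < l (a f))%R.
  move=> fE fe; have := aC' f; rewrite in_setD1 fe fE => /(_ isT) /setDP[aC].
  have := rmin (f, a f); rewrite /P /= fE aC => /(_ isT) => rv.
  by rewrite !inE rv (subsetP (CZ f fE) _ aC) andbT /= -ltNge.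
exists (fun f => if f == e then v else a f); split=> [f fE|f g fE gE fg].
  have [->//|fe] := eqVneq f e; have := aC' f.
  by rewrite in_setD1 fe fE => /(_ isT) /setDP[].
have [fe|fe] := eqVneq f e; have [ge|ge] := eqVneq g e.
- by rewrite fe ge eqxx in fg.
- by rewrite sep.
- by rewrite sep ?orbT.
- by apply: adis; rewrite // in_setD1 ?fe ?ge.
Qed.

(** One-point intervals placed by [enum_rank] have depth one, and separated points are distinct. *)
Lemma distinct_choice (R V : finType) (v0 : V) (E : {set R}) (C : R -> {set V}) :
  (forall e, e \in E -> #|E| <= #|C e|) ->
  exists a : R -> V, (forall e, e \in E -> a e \in C e) /\ {in E &, injective a}.
Proof.
move=> EC; pose rk (v : V) : int := Posz (enum_rank v).
have [||t|e _|e eE|a [aC adis]] :=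
  @disjoint_interval_choice R V rk rk 1 setT v0 E C.
- by [].
- by [].
- case: (set_0Vmem [set v in [set: V] | (rk v <= t <= rk v)%R]) => [->|[v]].
    by rewrite cards0.
  rewrite !inE /= => vt; apply: (@leq_trans #|[set v]|); last by rewrite cards1.
  apply/subset_leq_card/subsetP => x; rewrite !inE /= => xt.
  apply/eqP/enum_rank_inj/val_inj; move: vt xt; rewrite /rk /=; lia.
- exact: subsetT.
- by rewrite mul1n EC.
exists a; split=> // e e' eE e'E aee; apply: contraTeq isT => ne.
by have := adis e e' eE e'E ne; rewrite aee ltxx.
Qed.

Section Sinks.
Variables (V : finType) (E : rel V).
Hypothesis Esemi : semicomplete E.

(** A vertex of maximum in-degree inside [A] does it: the average in-degree is at least half of
    [#|A|.-1]. *)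
Lemma half_indegree (A : {set V}) : A != set0 ->
  exists2 w, w \in A & #|A|.-1 <= 2 * #|[set x in A | E x w]|.
Proof.
move=> A0; have [w wA wmin] : exists2 w, w \in A &
    forall x, x \in A -> #|[set y in A | E y x]| <= #|[set y in A | E y w]|.
  have [x xA] := set0Pn _ A0.
  by case: (arg_maxnP (fun w => #|[set y in A | E y w]|) xA) => w wA wm; exists w.
exists w => //.
have cE x : #|[set y in A | E y x]| = \sum_(y in A) (E y x : nat).
  by rewrite -sum1_card -big_mkcondr; apply: eq_bigl => y; rewrite inE.
have lo : \sum_(x in A) \sum_(y in A) ((E y x : nat) + E x y) >= #|A| * #|A|.-1.
  rewrite -sum_nat_const; apply: leq_sum => x xA.
  rewrite (bigD1 x) //= -[X in X <= _]add0n leq_add //.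
  rewrite -[#|A|.-1]muln1 (_ : #|A|.-1 = #|A :\ x|); last by rewrite (cardsD1 x A) xA.
  rewrite -sum_nat_const (eq_bigl (fun i => (i \in A) && (i != x))); last first.
    by move=> i; rewrite !inE andbC.
  apply: leq_sum => y /andP[_ yx]; have := Esemi yx; by case: E; case: E.
have hi : \sum_(x in A) \sum_(y in A) ((E y x : nat) + E x y) <=
    #|A| * (2 * #|[set y in A | E y w]|).
  rewrite (eq_bigr _ (fun x _ => big_split _ _ _ _ _)) big_split /=.
  rewrite [X in _ + X]exchange_big /= addnn -mul2n mulnCA leq_mul2l /=.
  rewrite -sum_nat_const; apply: leq_sum => x xA; rewrite -cE; exact: wmin.
have cA : 0 < #|A| by rewrite card_gt0.
by move: (leq_trans lo hi); rewrite leq_pmul2l.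
Qed.

(** Only interior vertices must avoid [F]; the ends may lie in [F], and putting [u] there keeps the
    route from returning to its start. *)
Definition short_link (F : {set V}) (u v : V) : Prop :=
  [\/ E u v, exists2 b, b \notin F & E u b && E b v
   | exists b c, [&& b \notin F, c \notin F, b != c, E u b, E b c & E c v]].

(* If u had few short routes to v, all in-neighbours of v would dominate
   the out-neighbours of u, and one of the latter would beat the in-degree of v. *)
Lemma max_indegree_short_link (R F : {set V}) (u v : V) :
  v \in R ->
  (forall w, w \in R -> #|[set x in R | E x w]| <= #|[set x in R | E x v]|) ->
  3 * #|F| + 1 < #|[set y in R | E u y]| -> short_link F u v.
Proof.
move=> vR vmax uF; have [?|uv] := boolP (E u v); first exact: Or31.
pose A := [set y in R | E u y] :\: F; pose B := [set x in R | E x v] :\: F.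
have cA : #|[set y in R | E u y]| <= #|A| + #|F|.
  rewrite cardsD; have := subset_leq_card (subsetIr [set y in R | E u y] F).
  by have := subset_leq_card (subsetIl [set y in R | E u y] F); lia.
have cB : #|[set x in R | E x v]| <= #|B| + #|F|.
  rewrite cardsD; have := subset_leq_card (subsetIr [set y in R | E y v] F).
  by have := subset_leq_card (subsetIl [set y in R | E y v] F); lia.
have [b bAB|dAB] := pickP [pred b | (b \in A) && (b \in B)].
  move: bAB; rewrite !inE => /andP[/and3P[bF _ ub] /and3P[_ _ bv]].
  by apply: Or32; exists b; rewrite ?ub.
have [w wA wdeg] : exists2 w, w \in A & #|A|.-1 <= 2 * #|[set x in A | E x w]|.
  by apply: half_indegree; rewrite -card_gt0; lia.
have [b|noWB] := pickP [pred b | (b \in B) && E w b].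
  move=> /andP[bB wb]; move: wA bB (dAB w) (dAB b); rewrite !inE.
  move=> /and3P[wF wR uw] /and3P[bF bR bv].
  rewrite wF wR uw bF bR bv /= !andbT => _ ub; apply: Or33; exists w, b.
  by rewrite wF bF uw wb bv /= andbT; apply: contraFneq ub => <-.
have wR : w \in R by move: wA; rewrite !inE => /and3P[].
have sub : B :|: [set x in A | E x w] \subset [set x in R | E x w].
  apply/subsetP=> x /setUP[xB|]; last first.
    by rewrite !inE => /andP[/and3P[_ -> _] ->].
  have := noWB x; rewrite /= xB /= => wx.
  have xA : x \notin A by apply/negP => xA; have := dAB x; rewrite /= xA xB.
  have xw : x != w by apply: contraNneq xA => ->.
  by move: xB (Esemi xw); rewrite wx orbF !inE => /and3P[_ -> _] ->.
have dis : [disjoint B & [set x in A | E x w]].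
  rewrite disjoint_subset; apply/subsetP => x xB; rewrite !inE.
  by apply/negP => /andP[xA _]; have := dAB x; rewrite /= xB andbT !inE xA.
have := subset_leq_card sub; rewrite cardsU.
rewrite (disjoint_setI0 dis) cards0; have := vmax w wR; lia.
Qed.

(** Sinks are picked one by one, each of maximum in-degree in what remains; the vertices taken
    earlier lower out-degrees by less than [t]. *)
Lemma exists_sinks (d t : nat) :
  (forall u, d <= #|[set y | E u y]|) -> t <= d -> t <= #|V| ->
  exists U : {set V}, #|U| = t /\ forall u v (F : {set V}), v \in U -> u != v ->
    3 * #|F| + 1 + t < d -> short_link F u v.
Proof.
move=> dP; elim: t => [|t IH] td tV.
  by exists set0; split=> [|u v F]; rewrite ?cards0 ?inE.
have [U [cU UP]] := IH (ltnW td) (ltnW tV).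
have [v vU] : exists v, v \in ~: U by apply/card_gt0P; rewrite cardsCs setCK cU subn_gt0.
case: (arg_maxnP (fun v => #|[set x in ~: U | E x v]|) vU) => w wU wmax.
have wU' : w \notin U by rewrite -in_setC.
exists (w |: U); split; first by rewrite cardsU1 wU' cU.
move=> x y F /setU1P[->|yU] xy Fd; last by apply: UP => //; lia.
apply: (max_indegree_short_link wU wmax).
have -> : [set y in ~: U | E x y] = [set y | E x y] :\: U.
  by apply/setP => z; rewrite !inE.
rewrite cardsD; have := dP x; have := subset_leq_card (subsetIr [set y | E x y] U); lia.
Qed.
End Sinks.

(** * Switching permutations along residual cycles *)

Section Linkages.
Variables (N : finType) (K U : {set N}) (G : rel N).
Hypothesis Girr : irreflexive G.
Hypothesis GK : forall k, k \in K -> forall i, G k i = (i \in U).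

(** A fixed point stands for a vertex off all paths, so tokens may not be fixed. *)
Definition allowed i j := if i == j then i \notin K else G i j.
Definition feasible (s : {perm N}) := [forall i, allowed i (s i)].
(* [i] may take over the image of [j]. *)
Definition residual (s : {perm N}) i j := (i != j) && allowed i (s j).

(* Counting all of [K] on the right asks for one unit more than Hall's condition for a
   permutation: this is what makes every point reachable in the residual digraph. *)
Hypothesis Gconn : forall T : {set N}, ~~ [disjoint T & K] ->
  #|[set j | [exists i in T, allowed i j]]| <= #|T :|: K| ->
  [set j | [exists i in T, allowed i j]] = setT.

(** Composed before [s], it hands each vertex of [c] the [s]-image of its successor on [c]; along a
    residual cycle this keeps [s] feasible. *)
Definition rotation (c : seq N) (Uc : uniq c) : {perm N} :=
  perm (can_inj (prev_next Uc)).

Lemma rotationE c (Uc : uniq c) i : rotation Uc i = next c i.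
Proof. by rewrite permE. Qed.

Lemma next_notin (c : seq N) i : i \notin c -> next c i = i.
Proof. by rewrite next_nth => /negPf->. Qed.

(** If a reachable [i] may map to [j], it may take [j] over from [s^-1 j], which is then reachable
    too. So the reachable set has at most as many neighbours as elements. *)
Lemma neighbours_sub_image (s : {perm N}) k :
  [set j | [exists i in [set i | connect (residual s) k i], allowed i j]]
    \subset s @: [set i | connect (residual s) k i].
Proof.
apply/subsetP => j; rewrite inE => /exists_inP[i]; rewrite inE => ki ij.
rewrite -[j](permKV s); apply: imset_f; rewrite inE.
have [<-//|ne] := eqVneq i (s^-1 j)%g.
by apply: connect_trans ki (connect1 _); rewrite /residual ne permKV.
Qed.

(** Augmentation: among permutations that may also fix tokens, fix as few tokens as possible.
    Rotating a cycle through a fixed token [k] would free it; without such a cycle, the neighbours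
    of the set reachable from [k] miss [k], against [Gconn]. *)
Lemma exists_feasible : exists s, feasible s.
Proof.
pose weak (s : {perm N}) := [forall i, (s i == i) || G i (s i)].
have weak1 : weak 1%g by apply/forallP => i; rewrite perm1 eqxx.
case: (arg_minnP (fun s : {perm N} => #|[set k in K | s k == k]|) weak1) => s ws smin.
exists s; apply/forallP => k; rewrite /allowed.
case: eqP => [ks|/eqP ks]; last first.
  by have := forallP ws k; rewrite eq_sym (negPf ks).
apply/negP => kK; have sk : s k = k by [].
pose T := [set i | connect (residual s) k i].
have kT : k \in T by rewrite inE connect0.
have sub : [set j | [exists i in T, allowed i j]] \subset s @: T.
  exact: neighbours_sub_image.
have [i /andP[iT ik]|noi] := pickP [pred i | (i \in T) && G i k].
  move: iT; rewrite inE => /connectP[p0 p0E ei].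
  case/shortenP: p0E ei => p pE Up _ ei.
  have cyc : cycle (residual s) (k :: p).
    rewrite /= rcons_path pE -ei /residual /allowed sk.
    have ik' : i != k by apply: contraTneq ik => ->; rewrite Girr.
    by rewrite ik' (negPf ik') ik.
  pose s' := (rotation Up * s)%g.
  have s'E j : s' j = s (next (k :: p) j) by rewrite permM rotationE.
  have s'in j : j \in k :: p -> allowed j (s' j).
    by move=> /(next_cycle cyc) /andP[_]; rewrite s'E.
  have ws' : weak s'.
    apply/forallP => j; have [jp|jp] := boolP (j \in k :: p).
      by have := s'in j jp; rewrite /allowed eq_sym; case: eqP.
    rewrite s'E next_notin //; exact: (forallP ws j).
  have := smin s' ws'; rewrite leqNgt => /negP; apply.
  apply: proper_card; apply/properP; split.
    apply/subsetP => j; rewrite !inE => /andP[jK /eqP s'j]; rewrite jK /=.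
    have [jp|jp] := boolP (j \in k :: p).
      by have := s'in j jp; rewrite /allowed s'j eqxx jK.
    by rewrite -{2}s'j s'E next_notin.
  exists k; rewrite !inE kK; first by rewrite sk eqxx.
  by apply/negP => /eqP s'k; have := s'in k (mem_head _ _); rewrite /allowed s'k eqxx kK.
have disTK : ~~ [disjoint T & K] by apply/pred0Pn; exists k; rewrite /= kT.
have := Gconn disTK; rewrite (leq_trans (subset_leq_card sub)); last first.
  rewrite card_imset; [exact: subset_leq_card (subsetUl _ _) | exact: perm_inj].
move=> /(_ isT) /setP /(_ k); rewrite !inE => /exists_inP[i iT].
rewrite /allowed; case: eqP => [->|_ ik]; first by rewrite kK.
by have := noi i; rewrite /= iT ik.
Qed.

Lemma feasibleP s i : feasible s -> allowed i (s i).
Proof. by move=> /forallP. Qed.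

Lemma residual_connected s k j : feasible s -> k \in K -> connect (residual s) k j.
Proof.
move=> fs kK; pose T := [set i | connect (residual s) k i].
have kT : k \in T by rewrite inE connect0.
have sub : [set j | [exists i in T, allowed i j]] \subset s @: T.
  exact: neighbours_sub_image.
have disTK : ~~ [disjoint T & K] by apply/pred0Pn; exists k; rewrite /= kT.
have cT : #|[set j | [exists i in T, allowed i j]]| <= #|T :|: K|.
  apply: leq_trans (subset_leq_card sub) _.
  rewrite card_imset; [exact: subset_leq_card (subsetUl _ _) | exact: perm_inj].
rewrite (Gconn disTK cT) in sub.
by have := subsetP sub (s j) (in_setT _); rewrite mem_imset ?inE //; exact: perm_inj.
Qed.

Definition cost (s : {perm N}) := #|[set i | s i != i]|.

(** The new status of [i] (moved or not), once it takes over the image of [j], against the old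
    status of [j]. Summed around a cycle this is the change of [cost]. *)
Definition weight (s : {perm N}) (i j : N) : int :=
  ((i != s j : nat)%:Z - (j != s j : nat)%:Z)%R.

Lemma cost_rotation s c (Uc : uniq c) :
  ((cost (rotation Uc * s)%g)%:Z = (cost s)%:Z + \sum_(i <- c) weight s i (next c i))%R.
Proof.
have cE (t : {perm N}) : ((cost t)%:Z = \sum_i (i != t i : nat)%:Z)%R.
  rewrite /cost -sum1_card big_mkcond /= (big_morph Posz PoszD (erefl _)).
  by apply: eq_bigr => i _; rewrite inE eq_sym; case: eqP.
have -> : (\sum_(i <- c) weight s i (next c i) = \sum_i weight s i (next c i))%R.
  rewrite (big_uniq _ Uc) /= big_mkcond; apply: eq_bigr => i _.
  by case: ifP => // /negbT ic; rewrite next_notin // /weight subrr.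
rewrite !cE [X in (X + _)%R](reindex_inj (@perm_inj _ (rotation Uc))) /= -big_split /=.
apply: eq_bigr => i _; rewrite permM rotationE /weight; lia.
Qed.

(** Rotating a negative residual cycle would give a cheaper feasible permutation, so at minimum cost
    shortest walks define a potential. *)
Lemma exists_tight_potential : K != set0 -> exists (s : {perm N}) (pi : N -> int) k0,
  [/\ feasible s, k0 \in K, pi k0 = 0%R,
      forall i j, residual s i j -> (pi j <= pi i + weight s i j)%R
    & forall j, exists2 p,
        path (fun x y => residual s x y && (pi y == pi x + weight s x y)%R) k0 p
        & last k0 p = j].
Proof.
move=> /set0Pn[k0 k0K]; have [s0 fs0] := exists_feasible.
case: (arg_minnP cost fs0) => s fs smin.
have [] := @shortest_walk_potential N (residual s) (weight s) k0.
- by move=> j; apply: residual_connected.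
- move=> x c Uc cyc; rewrite walk_weight_cycle //.
  have fs' : feasible (rotation Uc * s)%g.
    apply/forallP => i; rewrite permM rotationE.
    have [ic|ic] := boolP (i \in x :: c); last by rewrite next_notin // feasibleP.
    by have /andP[] := next_cycle cyc ic.
  by have := smin _ fs'; have := cost_rotation s Uc; lia.
by move=> pi [pi0 pitri pitight]; exists s, pi, k0.
Qed.

(** * Levels and windows of a cheapest path system *)

Section Tight.
Hypothesis Gsemi : forall i j, i \notin K -> j \notin K -> i != j -> G i j || G j i.
Variables (s : {perm N}) (pi : N -> int) (k0 : N).
Hypothesis fs : feasible s.
Hypothesis k0K : k0 \in K.
Hypothesis pi0 : pi k0 = 0%R.
Hypothesis pi_le : forall i j, residual s i j -> (pi j <= pi i + weight s i j)%R.

Definition tight x y := residual s x y && (pi y == pi x + weight s x y)%R.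
Hypothesis pi_tight : forall j, exists2 p, path tight k0 p & last k0 p = j.

(* Potential at which a path enters [j]; [pi j] is the one at which it leaves [j]. *)
Definition entry j : int := (pi (s^-1 j)%g + ((s^-1 j)%g != j : nat)%:Z)%R.

Lemma token_moved k : k \in K -> s k != k.
Proof. by move=> kK; have := feasibleP k fs; rewrite /allowed eq_sym; case: eqP; rewrite ?kK. Qed.

Lemma fixed_notin_K i : s i = i -> i \notin K.
Proof. by move=> si; apply/negP => /token_moved; rewrite si eqxx. Qed.

Lemma moved_arc i : s i != i -> G i (s i).
Proof. by move=> si; have := feasibleP i fs; rewrite /allowed eq_sym (negPf si). Qed.

(** All tokens have the same out-neighbours, so each may take over the image of any other at weight
    0. *)
Lemma pi_K k : k \in K -> pi k = 0%R.
Proof.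
have swap k1 k2 : k1 \in K -> k2 \in K -> (pi k2 <= pi k1)%R.
  move=> k1K k2K; have [->//|k12] := eqVneq k1 k2.
  have Gk := moved_arc (token_moved k2K).
  have G1 : G k1 (s k2) by rewrite GK // -(GK k2K).
  have n1 : k1 != s k2 by apply: contraTneq G1 => <-; rewrite Girr.
  have := @pi_le k1 k2; rewrite /residual k12 /allowed (negPf n1) G1 => /(_ isT).
  by rewrite /weight n1 eq_sym token_moved // subrr addr0.
by move=> kK; have := swap k k0 kK k0K; have := swap k0 k k0K kK; rewrite pi0; lia.
Qed.

Lemma entry_image j : entry (s j) = (pi j + (s j != j : nat)%:Z)%R.
Proof. by rewrite /entry permK eq_sym. Qed.

(** [i] may take [j] over from [s^-1 j]; [entry] absorbs the weight of that step except for the unit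
    by which [i] is moved. *)
Lemma entry_arc i j : G i j -> (entry j <= pi i + 1)%R.
Proof.
move=> ij; rewrite /entry; have [<-|ne] := eqVneq i (s^-1 j)%g; first by clear; lia.
have nij : i != j by apply: contraTneq ij => ->; rewrite Girr.
have := @pi_le i (s^-1 j)%g; rewrite /residual ne permKV /allowed (negPf nij) ij.
by move=> /(_ isT); rewrite /weight permKV nij; clear; lia.
Qed.

(** A vertex off [K] may become fixed, taking itself over from its predecessor: if it was moved,
    this step has weight -1. *)
Lemma entry_le i : i \notin K -> (entry i <= pi i)%R.
Proof.
move=> iK; rewrite /entry; have [e|ne] := eqVneq (s^-1 i)%g i; first by rewrite e addr0.
have := @pi_le i (s^-1 i)%g; rewrite /residual eq_sym ne permKV /allowed eqxx iK.
by move=> /(_ isT); rewrite /weight permKV eqxx ne; clear; lia.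
Qed.

Lemma entry_fixed i : s i = i -> entry i = pi i.
Proof. by move=> si; rewrite -{1}si entry_image si eqxx addr0. Qed.

Lemma inv_moved i : s i != i -> s (s^-1 i)%g != (s^-1 i)%g.
Proof. by move=> si; rewrite permKV; apply: contraNneq si => {1}->; rewrite permKV. Qed.

Lemma entry_moved i : s i != i -> entry i = (pi (s^-1 i)%g + 1)%R.
Proof. by move=> /inv_moved; rewrite permKV /entry eq_sym => ->. Qed.

(** At a moved non-token of least potential the predecessor must be a token, of potential 0: any
    other predecessor would be lower still. *)
Lemma entry_gt0 i : i \notin K -> s i != i -> (1 <= entry i)%R.
Proof.
move=> iK si; pose P x := (x \notin K) && (s x != x).
have Pi : P i by rewrite /P iK.
case: (arg_minP pi Pi) => j /andP[jK sj] jmin.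
have jp : (1 <= pi j)%R.
  have := entry_le jK; rewrite entry_moved // => le.
  have [/pi_K e|jK'] := boolP ((s^-1 j)%g \in K); first by move: le e; clear; lia.
  by have := jmin (s^-1 j)%g; rewrite /P jK' inv_moved // => /(_ isT); move: le; clear; lia.
rewrite entry_moved //; have [/pi_K ->|jK'] := boolP ((s^-1 i)%g \in K); first by [].
by have := jmin (s^-1 i)%g; rewrite /P jK' inv_moved // => /(_ isT); move: jp; clear; lia.
Qed.

Definition entered (t : int) := [set i | [&& i \notin K, s i != i & (entry i <= t)%R]].
Definition left_by (t : int) := [set i | [&& i \notin K, s i != i & (pi i <= t)%R]].

(** The predecessor of a vertex entered by level [t] is a token or was left by level [t - 1]. *)
Lemma card_entered_left t : #|entered t| <= #|K| + #|left_by (t - 1)%R|.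
Proof.
apply: leq_trans (leq_card_setU K (left_by (t - 1)%R)).
rewrite -(card_imset (mem (K :|: _)) (@perm_inj _ s)); apply/subset_leq_card/subsetP => i.
rewrite !inE => /and3P[iK si it]; rewrite -[i](permKV s); apply: imset_f.
rewrite !inE; case: (boolP (_ \in K)) => //= jK; rewrite inv_moved //=.
by move: it; rewrite entry_moved //; clear; lia.
Qed.

Lemma left_entered t : left_by t \subset entered t.
Proof.
apply/subsetP => i; rewrite !inE => /and3P[iK -> it]; rewrite iK /=.
exact: le_trans (entry_le iK) it.
Qed.

Lemma card_entered_add (n : nat) (t : int) :
  #|entered (t + n%:Z)%R| <= n.+1 * #|K| + #|left_by (t - 1)%R|.
Proof.
elim: n => [|n IH]; first by rewrite addr0 mul1n card_entered_left.
apply: leq_trans (card_entered_left _) _; rewrite mulSn -addnA leq_add2l.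
apply: leq_trans IH; apply: subset_leq_card.
have -> : (t + n.+1%:Z - 1 = t + n%:Z)%R by clear; lia.
exact: left_entered.
Qed.

Lemma card_entered (n : nat) : #|entered n%:Z| <= n * #|K|.
Proof.
case: n => [|n].
  rewrite mul0n leqn0 cards_eq0; apply/eqP/setP => i; rewrite !inE.
  by apply/negP => /and3P[iK si]; move: (entry_gt0 iK si); clear; lia.
have := card_entered_add n 1%R; have -> : (1 + n%:Z = n.+1%:Z)%R by clear; lia.
rewrite (_ : left_by _ = set0) ?cards0 ?addn0 //; apply/setP => i; rewrite !inE.
by apply/negP => /and3P[iK si]; move: (entry_gt0 iK si) (entry_le iK); clear; lia.
Qed.

(** The margins of 2 come from [entry_arc]: a fixed point at level [win_lo v] is too low to dominate
    the predecessor of [v], and one at [win_hi v] too high to be dominated by the successor of [v].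
    Semicompleteness then gives the opposite arcs. *)
Definition win_lo v : int := (entry (s^-1 v)%g - 2)%R.
Definition win_hi v : int := (pi (s v) + 2)%R.

(** The bound 7 puts every window at level 5 or above, clear of the levels up to 4 kept for short
    routes. *)
Definition movable := [set v | [&& v \notin K, s v != v, s v \notin K,
  (s^-1 v)%g \notin K & (7 <= entry (s^-1 v)%g)%R]].

Lemma movable_levels v : v \in movable ->
  [/\ [/\ v \notin K, s v \notin K, (s^-1 v)%g \notin K & s v != v],
      entry v = (pi (s^-1 v)%g + 1)%R, entry (s v) = (pi v + 1)%R,
      (7 <= entry (s^-1 v)%g)%R
    & [/\ (entry (s^-1 v)%g <= pi (s^-1 v)%g)%R, (entry v <= pi v)%R
       & (entry (s v) <= pi (s v))%R]].
Proof.
rewrite in_set => /and5P[vK sv cK aK a7].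
split; [by [] | exact: entry_moved | by rewrite entry_image sv | by [] |].
by split; apply: entry_le.
Qed.

Lemma movable_window v : v \in movable -> ((win_lo v <= pi v) && (pi v <= win_hi v))%R.
Proof.
move=> /movable_levels[_ ev ec _ [lea lev lec]].
by rewrite /win_lo /win_hi; move: ev ec lea lev lec; clear; lia.
Qed.

Lemma card_windows (t : int) :
  #|[set v in movable | ((win_lo v <= t) && (t <= win_hi v))%R]| <= 15 * #|K|.
Proof.
pose M := entered (t + 2)%R :\: left_by (t - 3)%R.
have cM : #|M| <= 5 * #|K|.
  have := card_entered_add 4 (t - 2)%R.
  have -> : (t - 2 + 4%:Z = t + 2)%R by clear; lia.
  have -> : (t - 2 - 1 = t - 3)%R by clear; lia.
  have sub : left_by (t - 3)%R \subset entered (t + 2)%R.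
    apply/subsetP => i; rewrite !inE => /and3P[iK -> it]; rewrite iK /=.
    by move: it (entry_le iK); clear; lia.
  by rewrite cardsD (setIidPr sub); clear; lia.
have -> : 15 * #|K| = 5 * #|K| + 5 * #|K| + 5 * #|K| by clear; lia.
apply: (@leq_trans #|(s @: M) :|: M :|: (s^-1)%g @: M|); last first.
  apply: leq_trans (leq_card_setU _ _) _; apply: leq_add.
    apply: leq_trans (leq_card_setU _ _) _; apply: leq_add => //.
    by rewrite card_imset //; exact: perm_inj.
  by rewrite card_imset //; exact: perm_inj.
apply/subset_leq_card/subsetP => v; rewrite in_set => /andP[].
move=> /movable_levels[[vK cK aK sv] ev ec _ _] /andP[].
rewrite /win_lo /win_hi => lo hi; have sa := inv_moved sv.
have ssv : s (s v) != s v by rewrite (inj_eq perm_inj).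
rewrite !in_setU.
(* One of predecessor, [v] and successor lies in [M]: if the first two are left by level [t - 3],
   the successor is entered by [t - 2] but not left by [t - 3]. *)
have [a3|a3] := leP (pi (s^-1 v)%g) (t - 3)%R; last first.
  rewrite -{1}[v](permKV s) imset_f // !inE aK sa /= -ltNge a3 /=; move: lo; clear; lia.
have [v3|v3] := leP (pi v) (t - 3)%R; last first.
  have -> : v \in M by rewrite !inE vK sv -ltNge v3 ev /=; move: a3; clear; lia.
  by rewrite orbT.
by rewrite -{3}[v](permK s) imset_f ?orbT // !inE cK ssv ec /=; move: v3 hi; clear; lia.
Qed.

Lemma tight_rise x y : tight x y ->
  (pi y <= pi x)%R \/ (pi y = pi x + 1)%R /\ s y = y.
Proof.
move=> /andP[_ /eqP ->]; rewrite /weight.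
case: (eqVneq y (s y)) => [<-|ne] /=; case: (x == _) => /=.
- by left; rewrite subrr addr0.
- by right; rewrite subr0.
- by left; clear; lia.
- by left; rewrite subrr addr0.
Qed.

(** Rises are by one and end at fixed points, so the first vertex not below [b] has potential
    exactly [b]. *)
Lemma tight_truncate b x p : path tight x p -> (pi x < b)%R ->
  all (fun z => (pi z < b)%R) p \/
  exists p1 y p2, [/\ p = p1 ++ y :: p2, all (fun z => (pi z < b)%R) p1,
                      pi y = b & s y = y].
Proof.
elim: p x => [|y p IH] x /=; first by left.
move=> /andP[xy yp] xb; have [yb|yb] := ltP (pi y) b; last first.
  right; exists [::], y, p; have := tight_rise xy.
  case=> [yl|[ey sy]]; first by have := le_lt_trans yl xb; rewrite ltNge yb.
  by split=> //; apply/eqP; rewrite eq_le yb andbT ey lezD1.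
have [pb|[p1 [z [p2 [ep p1b zb sz]]]]] := IH y yp yb; first by left.
by right; exists (y :: p1), z, p2; rewrite ep /= yb.
Qed.

Lemma tight_suffix a x p : path tight x p -> (pi x < a)%R -> (a <= pi (last x p))%R ->
  exists p1 y p2, [/\ p = p1 ++ y :: p2, pi y = a, s y = y &
                      all (fun z => (a <= pi z)%R) p2].
Proof.
elim/last_ind: p => [|p z IH] /=; first by move=> _ xa /(lt_le_trans xa); rewrite ltxx.
rewrite rcons_path last_rcons => /andP[xp pz] xa za.
have [pa|pa] := ltP (pi (last x p)) a.
  exists p, z, [::]; rewrite cats1; have := tight_rise pz.
  case=> [zl|[ez sz]]; first by have := le_lt_trans zl pa; rewrite ltNge za.
  by split=> //; apply/eqP; rewrite eq_le za andbT ez lezD1.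
have [p1 [y [p2 [ep ya sy p2a]]]] := IH xp xa pa.
exists p1, y, (rcons p2 z); split=> //; first by rewrite ep rcons_cat.
by rewrite all_rcons za.
Qed.

Lemma sub_tight x p : path tight x p -> path (residual s) x p.
Proof. by apply: sub_path => y z /andP[]. Qed.

(* A shortest walk into [v] rises by at most one at a time and only at
   fixed points, so it has a stretch inside the window starting at a fixed
   point on its lowest level; if it leaves the window upwards, the fixed
   point where it does so can take over the successor of [v]. *)
Lemma window_walk v : v \in movable -> exists y p,
  [/\ s y = y, pi y = win_lo v, path (residual s) y p, last y p = v
    & all (fun z => (win_lo v <= pi z)%R && (pi z <= win_hi v)%R) p].
Proof.
move=> vmov; have vwin := movable_window vmov.
have [[vK cK aK sv] av ec a7 [lea lev lec]] := movable_levels vmov.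
have [p pt pv] := pi_tight v.
have lo0 : (pi k0 < win_lo v)%R by rewrite pi0 /win_lo; move: a7; clear; lia.
have hi0 : (pi k0 < win_hi v)%R by rewrite pi0 /win_hi; move: av ec lev lec lea a7; clear; lia.
have [pb|[p1 [y' [p2 [ep p1b y'b sy']]]]] := tight_truncate pt hi0.
  have lov : (win_lo v <= pi (last k0 p))%R by rewrite pv; case/andP: vwin.
  have [q1 [y [q2 [eq ya sy q2a]]]] := tight_suffix pt lo0 lov.
  exists y, q2; split=> //.
  - by have := sub_tight pt; rewrite eq cat_path => /= /and3P[].
  - by rewrite -pv eq last_cat.
  - apply/allP => z zq; rewrite (allP q2a z zq) /=; apply: ltW; apply: (allP pb).
    by rewrite eq mem_cat inE zq !orbT.
have pt1 : path tight k0 (rcons p1 y').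
  by move: pt; rewrite ep -cat_rcons cat_path => /andP[].
have loy' : (win_lo v <= pi (last k0 (rcons p1 y')))%R.
  by rewrite last_rcons y'b; case/andP: vwin; apply: le_trans.
have [q1 [y [q2 [eq ya sy q2a]]]] := tight_suffix pt1 lo0 loy'.
have lq2 : last y q2 = y' by rewrite -(last_rcons k0 p1 y') eq last_cat.
have y'K := fixed_notin_K sy'.
have y'v : residual s y' v.
  have ne : y' != v by apply: contraNneq sv => <-; rewrite sy'.
  have nc : y' != s v.
    by apply: contraNneq ne => e; rewrite -(inj_eq (@perm_inj _ s)) sy' e.
  rewrite /residual ne /allowed (negPf nc).
  have /orP[//|cy'] := Gsemi y'K cK nc.
  by have := entry_arc cy'; rewrite (entry_fixed sy') y'b /win_hi; clear; lia.
exists y, (rcons q2 v); split=> //.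
- rewrite rcons_path lq2 y'v andbT.
  by have := sub_tight pt1; rewrite eq cat_path => /= /and3P[].
- by rewrite last_rcons.
- rewrite all_rcons vwin /=; apply/allP => z zq; rewrite (allP q2a z zq) /=.
  have : z \in rcons p1 y' by rewrite eq mem_cat inE zq !orbT.
  by rewrite mem_rcons inE => /predU1P[->|/(allP p1b)/ltW]; rewrite ?y'b.
Qed.

(** The cycle runs from [v] to its predecessor [a], on to the low fixed point [y], and along the
    window walk back to [v]. Rotating gives [v] the image of [a], which is [v] itself, and so frees
    [v]. *)
Lemma window_rotation v : v \in movable -> exists rho : {perm N},
  [/\ rho v = (s^-1 v)%g, forall i, rho i = i \/ residual s i (rho i)
    & forall i, rho i != i -> ((win_lo v <= pi i) && (pi i <= win_hi v))%R].
Proof.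
move=> vmov; have [y [p [sy ylo yp pv pw]]] := window_walk vmov.
have [[vK cK aK sv] av ec a7 [lea lev lec]] := movable_levels vmov.
set a := (s^-1 v)%g in aK a7 av lea *; have sa : s a = v by rewrite /a permKV.
have va : v != a by have := inv_moved sv; rewrite permKV.
have ay : residual s a y.
  have ne : a != y.
    by apply: contraNneq va => e; rewrite -sa e sy -e.
  rewrite /residual ne /allowed sy (negPf ne).
  have /orP[//|ya] := Gsemi aK (fixed_notin_K sy) ne.
  by have := entry_arc ya; rewrite ylo /win_lo -/a; clear; lia.
have walk : path (residual s) a (y :: p) by rewrite /= ay.
have lv : last a (y :: p) = v by [].
have winE z : z \in a :: y :: p -> ((win_lo v <= pi z) && (pi z <= win_hi v))%R.
  rewrite !inE => /or3P[/eqP->|/eqP->|/(allP pw)//];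
    rewrite ?ylo /win_lo /win_hi -/a; move: av ec lev lec lea a7; clear; lia.
case/shortenP: walk lv => q qE Uq qsub lq.
have qwin z : z \in a :: q -> ((win_lo v <= pi z) && (pi z <= win_hi v))%R.
  by rewrite inE => zq; apply: winE; rewrite inE; case/orP: zq => [->//|/qsub->]; rewrite orbT.
case/lastP: q qE Uq lq qwin {qsub} => [|q z] qE Uq; first by move/eqP; rewrite eq_sym (negPf va).
rewrite last_rcons => zv qwin; rewrite {z}zv in qE Uq qwin.
have Uc : uniq (v :: a :: q) by move: Uq; rewrite -rcons_cons rcons_uniq.
have cyc : path.cycle (residual s) (v :: a :: q).
  by rewrite /= qE andbT /residual va sa /allowed eqxx.
exists (rotation Uc); split=> [|i|i]; rewrite ?rotationE.
- by rewrite /= eqxx.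
- have [ic|ic] := boolP (i \in v :: a :: q); last by left; rewrite next_notin.
  by right; apply: next_cycle cyc ic.
- have [ic _|ic] := boolP (i \in v :: a :: q); last by rewrite next_notin ?eqxx.
  by apply: qwin; move: ic; rewrite !inE mem_rcons !inE => /or3P[] ->; rewrite ?orbT.
Qed.

Definition windows_apart v v' := ((win_hi v < win_lo v') || (win_hi v' < win_lo v))%R.

(** Rotations with separated windows move disjoint sets of vertices, so each vertex is moved by at
    most one factor of their product, and every step stays residual for the same [s]. *)
Lemma combined_rotation (vs : {set N}) : vs \subset movable ->
  {in vs &, forall v v', v != v' -> windows_apart v v'} ->
  exists rho : {perm N},
  [/\ {in vs, forall v, rho v = (s^-1 v)%g}, forall i, rho i = i \/ residual s i (rho i)
    & forall i, rho i != i ->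
      exists2 v, v \in vs & ((win_lo v <= pi i) && (pi i <= win_hi v))%R].
Proof.
have [n] := ubnP #|vs|; elim: n vs => // n IH vs.
rewrite ltnS => vn vmov apart.
have [->|/set0Pn[v vvs]] := eqVneq vs set0.
  by exists 1%g; split=> [v|i|i]; rewrite ?inE ?perm1 ?eqxx //; left.
have sub : vs :\ v \subset vs by exact: subD1set.
have [] := IH (vs :\ v).
- by move: vn; rewrite (cardsD1 v) vvs.
- exact: subset_trans sub vmov.
- by move=> x y xv yv; apply: apart; apply: (subsetP sub).
move=> rho [rhov rhores rhowin].
have [tau [tauv taures tauwin]] := window_rotation (subsetP vmov v vvs).
have tau_out i v' : v' \in vs :\ v ->
    ((win_lo v' <= pi i) && (pi i <= win_hi v'))%R -> tau i = i.
  move=> /setD1P[ne v'vs] wi; apply/eqP/negPn/negP => /tauwin.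
  move: (apart v' v v'vs vvs ne) wi; rewrite /windows_apart; clear; lia.
have rho_out i : tau i != i -> rho i = i.
  move=> ti; apply/eqP/negPn/negP => /rhowin[v' v'vs /(tau_out _ _ v'vs) e].
  by rewrite e eqxx in ti.
exists (tau * rho)%g; split=> [v' v'vs|i|i]; rewrite permM.
- have [->|ne] := eqVneq v' v.
    (* [tau] sends [v] to its predecessor, so by injectivity it moves the predecessor, which [rho]
       therefore fixes. *)
    rewrite tauv; have [e|ne] := eqVneq (tau (s^-1 v)%g) (s^-1 v)%g; last exact: rho_out.
    have [[_ _ _ sv] _ _ _ _] := movable_levels (subsetP vmov v vvs).
    have : tau v = tau (s^-1 v)%g by rewrite e tauv.
    by move=> /perm_inj ve; have := inv_moved sv; rewrite permKV {1}ve eqxx.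
  have v'D : v' \in vs :\ v by rewrite in_setD1 ne.
  by rewrite (tau_out _ _ v'D (movable_window (subsetP vmov _ v'vs))) rhov.
- have [e|ne] := eqVneq (tau i) i; first by rewrite e.
  have ne' : tau (tau i) != tau i by rewrite (inj_eq perm_inj).
  by rewrite (rho_out _ ne').
- have [e|ne _] := eqVneq (tau i) i; last by exists v; rewrite ?tauwin.
  by rewrite e => /rhowin[v' /setD1P[_ v'vs] wv']; exists v'.
Qed.

(** The exceptions are the path neighbours of tokens, at most [2 * #|K|], and the successors of
    vertices entered by level 6, at most [6 * #|K|]. *)
Lemma card_movable (C : {set N}) : [disjoint C & K] ->
  #|C| <= #|[set v in C | s v == v]| + #|C :&: movable| + 8 * #|K|.
Proof.
move=> CK; pose X := s^-1%g @: K :|: s @: K :|: s @: entered 6%:Z.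
have cX : #|X| <= 8 * #|K|.
  apply: leq_trans (leq_card_setU _ _) _.
  have := (leq_card_setU (s^-1%g @: K) (s @: K)).1; have := card_entered 6.
  by rewrite !card_imset; try exact: perm_inj; clear; lia.
apply: (@leq_trans #|[set v in C | s v == v] :|: (C :&: movable) :|: X|); last first.
  apply: leq_trans (leq_card_setU _ _) _; apply: leq_add cX.
  exact: leq_card_setU.
apply/subset_leq_card/subsetP => v vC; rewrite !in_setU in_set vC in_setI vC /=.
have vK : v \notin K by apply: contraTN CK => vK; apply/pred0Pn; exists v; rewrite /= vC.
have [//|sv /=] := eqVneq (s v) v.
have [sK|sK] := boolP (s v \in K).
  by rewrite -{2}[v](permK s) imset_f ?orbT.
have [aK|aK] := boolP ((s^-1 v)%g \in K).
  by rewrite -{3}[v](permKV s) (imset_f s aK) ?orbT.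
have [a7|a7] := leP 7%R (entry (s^-1 v)%g); first by rewrite in_set vK sv sK aK a7.
have aE : (s^-1 v)%g \in entered 6%:Z.
  by rewrite in_set aK inv_moved //=; move: a7; clear; lia.
by have := imset_f s aE; rewrite permKV => ->; rewrite !orbT.
Qed.

End Tight.

(* [lev] is the entry potential and [B] the part of the minimal path system on levels at
   most 4: the vertices on these levels outside [B] stay off the switched paths, which is
   what paths of length at most three out of [U] and out of low exits need. *)
Lemma linkage_with_exits (R : finType) (C : R -> {set N}) :
  (forall i j, i \notin K -> j \notin K -> i != j -> G i j || G j i) ->
  [disjoint U & K] -> K != set0 -> #|R| <= #|K| ->
  (forall e, [disjoint C e & K]) -> (forall e, 40 * #|K| ^ 2 <= #|C e|) ->
  exists (s : {perm N}) (lev : N -> int) (B : {set N}) (a : R -> N),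
    [/\ feasible s, injective a, forall e, [/\ a e \in C e, s (a e) = a e & a e \notin B]
      & [/\ #|B| <= 4 * #|K|,
      forall i, i \notin K -> i \notin B -> (lev i <= 4)%R -> s i = i,
      forall i j, i \notin K -> i \notin B -> (lev i <= 4)%R -> G i j -> (lev j <= lev i + 1)%R,
      forall u, u \in U -> (lev u <= 1)%R &
      forall u j, u \in U -> u \notin B -> j \notin K -> (3 <= lev j)%R -> j != u -> G j u]].
Proof.
move=> Gsemi UK K0 RK CK Ccard.
have [s [pi [k0 [fs k0K pi0 pi_le pi_tight]]]] := exists_tight_potential K0.
have Kpos : 0 < #|K| by rewrite card_gt0.
pose lo := win_lo s pi; pose hi := win_hi s pi.
pose mov := movable s pi.
(* An index with at least [#|R|] candidates off the paths gets one of them as exit at once; the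
   others need a switch. *)
pose off e := [set v in C e | s v == v].
pose good := [set e | #|R| <= #|off e|].
have goodR : #|good| <= #|R| by exact: max_card.
have [a1 [a1C a1inj]] : exists a : R -> N,
    (forall e, e \in good -> a e \in off e) /\ {in good &, injective a}.
  by apply: (distinct_choice k0) => e; rewrite inE; apply: leq_trans.
pose hit e := [set v in mov | ((lo v <= pi (a1 e)) && (pi (a1 e) <= hi v))%R].
(* Windows containing an exit already chosen are avoided, so that switching does not disturb it. *)
pose D e := (C e :&: mov) :\: \bigcup_(e' in good) hit e'.
have lohi v : v \in mov -> (lo v <= hi v)%R.
  by move=> /(movable_window pi_le)/andP[]; apply: le_trans.
have windows t := card_windows pi_le t.
(* Of [40 * #|K| ^ 2] candidates, fewer than [9 * #|K|] are fixed or not movable and at most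
   [15 * #|K| ^ 2] fall to [hit]. At least [15 * #|K|] per index remain, matching the depth of the
   windows. *)
have Dcard e : e \in ~: good -> 15 * #|K| * #|~: good| <= #|D e|.
  rewrite in_setC inE -ltnNge => eoff.
  have gc : #|~: good| <= #|K| by exact: leq_trans (max_card _) RK.
  have cm := card_movable fs k0K pi0 pi_le (CK e).
  have hits : #|\bigcup_(e' in good) hit e'| <= #|K| * (15 * #|K|).
    apply: (@leq_trans (\sum_(e' in good) #|hit e'|)).
      elim/big_rec2: _ => [|e' n X _ h]; first by rewrite cards0.
      exact: leq_trans (leq_card_setU _ _) (leq_add (leqnn _) h).
    apply: (@leq_trans (\sum_(e' in good) 15 * #|K|)).
      by apply: leq_sum => e' _; apply: windows.
    by rewrite sum_nat_const leq_mul2r (leq_trans goodR RK) orbT.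
  have := subset_leq_card (subsetIr (C e :&: mov) (\bigcup_(e' in good) hit e')).
  have := Ccard e; rewrite /D cardsD -/(off e) -/mov in cm *.
  have : 15 * #|K| * #|~: good| <= 15 * #|K| * #|K| by rewrite leq_mul2l gc orbT.
  move: hits eoff RK Kpos cm; rewrite -/(off e) expnS expn1; clear; nia.
have [a2 [a2D a2apart]] : exists a : R -> N,
   (forall e, e \in ~: good -> a e \in D e) /\
   {in ~: good &, forall e e', e != e' ->
     ((hi (a e) < lo (a e')) || (hi (a e') < lo (a e)))%R}.
  apply: (disjoint_interval_choice (d := 15 * #|K|) (Z := mov) k0) => //.
  - by rewrite muln_gt0.
  - by move=> e _; apply: subset_trans (subsetDl _ _) (subsetIr _ _).
have a2mov e : e \in ~: good -> a2 e \in mov.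
  by move=> /a2D /setDP[/setIP[]].
have vsmov : a2 @: (~: good) \subset mov.
  by apply/subsetP => v /imsetP[e eb ->]; apply: a2mov.
have vsapart : {in a2 @: (~: good) &, forall v v', v != v' -> windows_apart s pi v v'}.
  move=> v v' /imsetP[e eb ->] /imsetP[e' eb' ->] ne; apply: a2apart => //.
  by apply: contraNneq ne => ->.
have [rho [rhov rhores rhowin]] :=
  combined_rotation Gsemi fs pi0 pi_le pi_tight vsmov vsapart.
pose s' : {perm N} := (rho * s)%g.
have s'E i : s' i = s (rho i) by rewrite permM.
have s'fix i : s i = i -> (forall v, v \in a2 @: (~: good) ->
    ~~ ((lo v <= pi i) && (pi i <= hi v))%R) -> s' i = i.
  move=> si nw; rewrite s'E; have [->//|/rhowin[v vvs wv]] := eqVneq (rho i) i.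
  by have := nw v vvs; rewrite wv.
have a1fix e : e \in good -> s (a1 e) = a1 e.
  by move=> /a1C; rewrite inE => /andP[_ /eqP].
have fixB i : s i = i -> i \notin entered s pi 4%:Z%R.
  by move=> si; rewrite in_set si eqxx andbF.
have movE v : v \in mov -> [/\ s v != v, (5 <= lo v)%R & (8 <= entry s pi v)%R].
  move=> /(movable_levels pi_le)[[_ _ _ sv] ev _ a7 [lea _ _]]; split=> //.
    by move: a7; rewrite /lo /win_lo; clear; lia.
  by move: ev lea a7; clear; lia.
pose a e := if e \in good then a1 e else a2 e.
have lowfix i : i \notin K -> i \notin entered s pi 4%:Z%R -> (entry s pi i <= 4)%R -> s i = i.
  by move=> iK; rewrite in_set iK /= => iB i4; move: iB; rewrite i4 andbT negbK => /eqP.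
have lowU u : u \in U -> (entry s pi u <= 1)%R.
  by rewrite -(GK k0K) => /(entry_arc pi_le); rewrite pi0.
(* Levels are those of [s] before the switch: windows start at level 5, so [s'] still fixes what [s]
   fixes at levels up to 4. *)
exists s', (entry s pi), (entered s pi 4%:Z%R), a; split; [| | |split].
- apply/forallP => i; rewrite s'E.
  by have [->|/andP[]] := rhores i; first exact: feasibleP.
- move=> e e'; rewrite /a; case: ifP => eg; case: ifP => e'g.
  + exact: a1inj.
  + move=> ee; have := a2mov e'; rewrite in_setC e'g => /(_ isT) /movE[].
    by rewrite -ee a1fix // eqxx.
  + move=> ee; have := a2mov e; rewrite in_setC eg => /(_ isT) /movE[].
    by rewrite ee a1fix // eqxx.
  + move=> ee; apply: contraTeq isT => ne.
    have := a2apart e e'; rewrite !in_setC eg e'g ee ne => /(_ isT isT isT).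
    have := lohi (a2 e'); rewrite a2mov ?in_setC ?e'g // => /(_ isT); clear; lia.
- move=> e; rewrite /a; case: ifP => eg.
    have := a1C e eg; rewrite inE => /andP[a1Ce _]; split=> //.
      apply: s'fix; first exact: a1fix.
      move=> v /imsetP[e' e'b ->]; have /setDP[/setIP[_ e'm]] := a2D e' e'b.
      by apply: contraNN => w; apply/bigcupP; exists e; rewrite // inE e'm.
    exact: fixB (a1fix e eg).
  have eb : e \in ~: good by rewrite in_setC eg.
  have /setDP[/setIP[a2C a2m] _] := a2D e eb; split=> //.
    by rewrite s'E rhov ?permKV // imset_f.
  have [_ _ e8] := movE _ a2m; rewrite in_set; apply/negP => /and3P[_ _].
  by move: e8; clear; lia.
- exact: (card_entered fs k0K pi0 pi_le 4).
- move=> i iK iB i4; apply: s'fix; first exact: lowfix.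
  have pii : (pi i <= 4)%R by rewrite -(entry_fixed pi (lowfix i iK iB i4)).
  move=> v /(subsetP vsmov) /movE[_ lo5 _]; move: lo5 pii; clear; lia.
- move=> i j iK iB i4 ij; rewrite (entry_fixed pi (lowfix i iK iB i4)).
  exact: (entry_arc pi_le).
- exact: lowU.
- move=> u j uU uB jK j3 ju.
  have uK : u \notin K by apply: contraTN UK => uK; apply/pred0Pn; exists u; rewrite /= uU.
  (* An arc from [u], a fixed point of level at most 1, would put [j] at level at most 2. *)
  have /orP[//|uj] := Gsemi j u jK uK ju.
  have u4 : (entry s pi u <= 4)%R by apply: le_trans (lowU u uU) _.
  have := entry_arc pi_le uj; rewrite -(entry_fixed pi (lowfix u uK uB u4)).
  by move: (lowU u uU) j3; clear; lia.
Qed.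
End Linkages.

(** * Path systems as permutations *)

Lemma iter_inj_sub (T : Type) (f : T -> T) a b i j : injective f -> i <= j ->
  iter i f a = iter j f b -> a = iter (j - i) f b.
Proof.
move=> fI; elim: i j => [|i IH] [|j] //= ij; by move=> /fI /IH; apply.
Qed.

Section TokenDigraph.
Variables (T V : finType) (E : rel V) (U : {set V}) (In : T -> {set V}).
Hypothesis Eirr : irreflexive E.

(* Every token [k] is both a source, with arcs to all of [U], and a sink, with arcs
   from [In k]; a permutation along these arcs that moves all tokens is a system of
   [#|T|] disjoint paths from [U] to the sets [In k]. *)
Definition token_arc (i j : T + V) : bool :=
  match i, j with
  | inl _, inl _ => false
  | inl _, inr u => u \in U
  | inr v, inl k => v \in In k
  | inr v, inr w => E v w
  end.
Definition tokens : {set T + V} := [set inl k | k in T].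

Lemma in_tokens i : (i \in tokens) = if i is inl _ then true else false.
Proof.
by case: i => x; apply/imsetP; [exists x | case].
Qed.

Lemma card_tokens : #|tokens| = #|T|.
Proof. by rewrite card_imset //; apply: inl_inj. Qed.

Lemma token_arc_irr : irreflexive token_arc.
Proof. by case=> x //=. Qed.

(** [Z] contains [U] because [A] has a token; if [A] has no vertex of [V], this alone makes [Z] too
    large. Otherwise cancelling the vertices of [A] leaves its boundary and the sets [In k] it
    meets, as counted in [conn]. *)
Lemma token_arc_connected :
  #|T| < #|U| ->
  (forall A : {set V}, A != set0 ->
    #|[set w | [exists v in A, E v w]] :\: A| + #|[set k | ~~ [disjoint A & In k]]| <= #|T| ->
    A = setT /\ forall k, ~~ [disjoint A & In k]) ->
  forall A : {set T + V}, ~~ [disjoint A & tokens] ->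
  #|[set j | [exists i in A, allowed tokens token_arc i j]]| <= #|A :|: tokens| ->
  [set j | [exists i in A, allowed tokens token_arc i j]] = setT.
Proof.
move=> TU conn A /pred0Pn[[k0 /= /andP[k0A _]|v /= /andP[_]]]; last by rewrite in_tokens.
set Z := [set j | _] => cZ.
pose B := [set v | inr v \in A].
pose H := [set k | ~~ [disjoint B & In k]].
pose F := [set w | [exists v in B, E v w]] :\: B.
have cA : #|A :|: tokens| <= #|B| + #|T|.
  rewrite -card_tokens -(card_imset _ (@inr_inj T V)).
  apply: leq_trans (leq_card_setU _ _); apply/subset_leq_card/subsetP => -[k|v].
    by rewrite !inE in_tokens !orbT.
  by rewrite !inE !in_tokens !orbF => vA; rewrite imset_f // inE.
have UZ : inr @: U \subset Z.
  apply/subsetP => _ /imsetP[u uU ->]; rewrite inE; apply/exists_inP.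
  by exists (inl k0).
have BZ v : v \in B -> inr v \in Z.
  by rewrite !inE => vA; apply/exists_inP; exists (inr v); rewrite // /allowed eqxx in_tokens.
have HZ k : k \in H -> inl k \in Z.
  rewrite !inE => /pred0Pn[v /= /andP[vB vk]]; apply/exists_inP; exists (inr v) => //.
  by move: vB; rewrite inE.
have B0 : B != set0.
  apply: contraTneq cZ => B0; rewrite -ltnNge; apply: leq_trans (subset_leq_card UZ).
  rewrite card_imset; last exact: inr_inj.
  by apply: leq_ltn_trans cA _; rewrite B0 cards0.
have FZ w : w \in F -> inr w \in Z.
  rewrite in_setD [w \in [set _ | _]]inE => /andP[wB /exists_inP[v vB vw]].
  rewrite inE; apply/exists_inP.
  exists (inr v); first by move: vB; rewrite inE.
  rewrite /allowed; case: eqP => [[e]|//]; by move: wB; rewrite -e vB.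
have sub : inr @: (B :|: F) :|: inl @: H \subset Z.
  apply/subsetP => i /setUP[/imsetP[v vBF ->]|/imsetP[k /HZ ? ->]] //.
  by case/setUP: vBF => [/BZ|/FZ].
have dBF : B :&: F = set0.
  by apply/setP => v; rewrite in_setI in_setD in_set0 andbA andbN.
have dis : (inr @: (B :|: F)) :&: (inl @: H) = set0.
  by apply/setP => i; rewrite !inE; apply/negP => /andP[/imsetP[? _ ->] /imsetP[? _]].
have cS : #|B| + (#|F| + #|H|) <= #|Z|.
  apply: leq_trans (subset_leq_card sub).
  rewrite cardsU dis cards0 subn0 !card_imset; [|exact: inl_inj|exact: inr_inj].
  by rewrite cardsU dBF cards0 subn0 addnA.
have [] := conn B B0.
  by have := leq_trans cS (leq_trans cZ cA); rewrite leq_add2l.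
move=> BT HT; apply/setP => -[k|v]; rewrite in_setT.
  by apply: HZ; rewrite inE.
by apply: BZ; rewrite BT.
Qed.

(** Running [s^-1] from [inl e] to the first token met, and reversing, gives a path from [U] into
    [In e]. *)
Lemma feasible_paths (s : {perm T + V}) : feasible tokens token_arc s ->
  exists p : T -> V * seq V,
    (forall e, [/\ (p e).1 \in U, path E (p e).1 (p e).2, last (p e).1 (p e).2 \in In e,
       uniq ((p e).1 :: (p e).2) & forall v, v \in (p e).1 :: (p e).2 -> s (inr v) != inr v])
    /\ forall e e' v, v \in (p e).1 :: (p e).2 -> v \in (p e').1 :: (p e').2 -> e = e'.
Proof.
move=> fs; pose f := (s^-1)%g : T + V -> T + V.
have fI : injective f by exact: perm_inj.
have moved e i : f (iter i f (inl e)) != iter i f (inl e).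
  elim: i => [|i IH]; last by rewrite (inj_eq fI).
  have := forallP fs (inl e); rewrite /allowed in_tokens.
  by case: eqP => // ne _; apply/eqP => /= fe; case: ne; rewrite -[in RHS]fe permKV.
(* If iterates from two tokens agree, cancelling the shorter shows a token among the iterates of the
   other; before the first token is met, this forces equality. *)
pose clean e i := forall j, 0 < j <= i -> iter j f (inl e) \notin tokens.
have once e e' i j : 0 < i -> 0 < j -> clean e i -> clean e' j ->
    iter i f (inl e) = iter j f (inl e') -> e = e' /\ i = j.
  wlog ij : e e' i j / i <= j => [wl|] i0 j0 ci cj eq.
    have [/wl|/ltnW /wl] := leqP i j; first by apply.
    by move=> /(_ e' e j0 i0 cj ci (esym eq)) [-> ->].
  have eq' := iter_inj_sub fI ij eq; have [ji|ji0] := posnP (j - i).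
    move: eq'; rewrite ji /= => -[->]; split=> //.
    by apply/eqP; rewrite eqn_leq ij -subn_eq0 ji.
   have := cj (j - i); rewrite ji0 leq_subr -eq' in_tokens.
  by move=> /(_ isT).
have ex e : exists p : V * seq V, [/\ p.1 \in U, path E p.1 p.2, last p.1 p.2 \in In e,
    uniq (p.1 :: p.2) & forall v, v \in p.1 :: p.2 ->
      s (inr v) != inr v /\ exists i, [/\ 0 < i, clean e i & inr v = iter i f (inl e)]].
  have exn : exists n, (0 < n) && (iter n f (inl e) \in tokens).
    by exists (order f (inl e)); rewrite order_gt0 iter_order // in_tokens.
  case: (ex_minnP exn) => -[//|n] /andP[_ nK] nmin.
  have cl i : 0 < i <= n -> iter i f (inl e) \notin tokens.
    move=> /andP[i0 ni]; apply/negP => iK.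
    by have := nmin i; rewrite i0 iK => /(_ isT); rewrite ltnNge ni.
  pose z := traject f (f (inl e)) n.
  have [q qz] : exists q, map inr q = rev z.
    have : all (fun i => i \notin tokens) (rev z).
      rewrite all_rev; apply/allP => _ /trajectP[i ni ->].
      by rewrite -iterSr cl.
    elim: (rev z) => [|i r IH] /=; first by exists [::].
    move=> /andP[iK /IH[q <-]]; move: iK; rewrite in_tokens.
    by case: i => // v _; exists (v :: q).
  have qi v : v \in q -> exists i, [/\ 0 < i <= n & inr v = iter i f (inl e)].
    move=> vq; have : inr v \in rev z by rewrite -qz map_f.
    by rewrite mem_rev => /trajectP[i ni ->]; exists i.+1; rewrite -iterSr.
  have Uq : uniq q.
    rewrite -(map_inj_uniq (@inr_inj T V)) qz rev_uniq /z.
    case: n cl {nK nmin z qz qi} => // n cl; rewrite looping_uniq.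
    apply/negP => /trajectP[i ni]; rewrite -!iterSr => eq.
    have eq' := iter_inj_sub fI (leqW ni) (esym eq).
    have hi : 0 < n.+1 - i.+1 <= n.+1 by lia.
    by have := cl _ hi; rewrite -eq' in_tokens.
  have pq : path token_arc (iter n.+1 f (inl e)) (rcons (map inr q) (inl e)).
    have bt : belast (inl e) (traject f (f (inl e)) n.+1) = inl e :: z.
      have := lastI (inl e) (traject f (f (inl e)) n.+1).
      by rewrite last_traject -trajectS trajectSr => /rcons_inj /(congr1 fst) /= <-.
    have : path (fun a b => f b == a) (last (inl e) (traject f (f (inl e)) n.+1))
        (rev (belast (inl e) (traject f (f (inl e)) n.+1))).
      by rewrite rev_path; exact: fpath_traject.
    rewrite last_traject bt rev_cons -qz => pf.
    have mov i : i \in rcons (map inr q) (inl e) -> f i != i.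
      rewrite mem_rcons inE => /predU1P[->|]; first exact: (moved e 0).
      by rewrite qz mem_rev => /trajectP[j _ ->]; rewrite -iterSr; exact: moved.
    apply: (sub_in_path (P := fun i => f i != i)) pf; last first.
      by apply/andP; split; [exact: (moved e n.+1) | exact/allP].
    move=> i j mi mj /eqP fji; have := forallP fs i.
    have <- : j = s i by rewrite -fji permKV.
    by rewrite /allowed eq_sym; case: eqP => // ij; case/eqP: mi; rewrite -{1}ij.
  have [k kE] : exists k, iter n.+1 f (inl e) = inl k.
    by move: nK; rewrite in_tokens; case: (iter n.+1 _ _) => // k; exists k.
  (* An empty path would be an arc between tokens. *)
  rewrite {}kE in pq; case: q qz qi Uq pq => [|h q] qz qi Uq.
    by [].
  rewrite map_cons rcons_cons /= => /andP[kh].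
  have -> : rcons (map inr q) (inl e) = map inr q ++ [:: inl e] by rewrite cats1.
  rewrite cat_path last_map /= andbT => /andP[hq qe].
  exists (h, q); split=> //=.
  - by move: hq; rewrite path_map.
  - move=> v vq; have [i [/andP[i0 ni] iE]] := qi v vq; split.
      have := moved e i; rewrite -iE; apply: contraNneq => sv.
      by rewrite -{1}sv /f permK.
    exists i; split=> // j /andP[j0 ji]; apply: cl; by rewrite j0 (leq_trans ji).
have [p pP] := fin_all_exists ex; exists p; split=> [e|e e' v].
  have [? ? ? ? pm] := pP e; split=> // v vp; exact: (pm v vp).1.
move=> ve ve'.
have [_ _ _ _ /(_ v ve)[_ [i [i0 ci iE]]]] := pP e.
have [_ _ _ _ /(_ v ve')[_ [j [j0 cj jE]]]] := pP e'.
by have [] := once e e' i j i0 j0 ci cj; rewrite -?iE.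
Qed.
End TokenDigraph.

(** * Linking exits to paths *)

(** Links are chosen one at a time, each avoiding the at most [c * #|T|] vertices of the earlier
    ones. *)
Lemma disjoint_links (T V : finType) (E : rel V) (F0 : {set V}) (P : pred V)
    (x h : T -> V) (c r : nat) :
  (forall e (F : {set V}), F0 \subset F -> #|F| <= #|F0| + c * #|T| ->
     exists l, [/\ size l <= c, path E (x e) (rcons l (h e)), uniq l &
                   forall z, z \in l -> z \notin F /\ P z]) ->
  exists L : T -> seq V,
    (forall e, [/\ path E (x e) (rcons (L e) (h e)), uniq (L e) &
                   forall z, z \in L e -> z \notin F0 /\ P z]) /\
    (forall e e' z, z \in L e -> z \in L e' -> e = e').
Proof.
move=> ex.
suff /(_ setT)[L [LP Ldis]] : forall S : {set T}, exists L : T -> seq V,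
    (forall e, e \in S -> [/\ size (L e) <= c, path E (x e) (rcons (L e) (h e)), uniq (L e) &
                   forall z, z \in L e -> z \notin F0 /\ P z]) /\
    (forall e e' z, e \in S -> e' \in S -> z \in L e -> z \in L e' -> e = e').
  exists L; split=> [e|e e' z]; last by apply: Ldis.
  by have [] := LP e.
move=> S; have [n] := ubnP #|S|; elim: n S => // n IH S; rewrite ltnS => Sn.
have [->|/set0Pn[e eS]] := eqVneq S set0.
  by exists (fun=> [::]); split=> [e|e e' z]; rewrite inE.
have SeS : #|S :\ e| < #|S| by rewrite [#|S|](cardsD1 e) eS.
have [L [LP Ldis]] := IH (S :\ e) (leq_trans SeS Sn).
pose F := F0 :|: \bigcup_(e' in S :\ e) [set z in L e'].
have cF : #|F| <= #|F0| + c * #|T|.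
  apply: leq_trans (leq_card_setU _ _) _; rewrite leq_add2l.
  apply: (@leq_trans (\sum_(e' in S :\ e) #|[set z in L e']|)).
    elim/big_rec2: _ => [|e' k X _ le]; first by rewrite cards0.
    exact: leq_trans (leq_card_setU _ _) (leq_add (leqnn _) le).
  apply: (@leq_trans (\sum_(e' in S :\ e) c)).
    apply: leq_sum => e' e'S; have [sz _ _ _] := LP e' e'S.
    by rewrite cardsE; apply: leq_trans (card_size _) sz.
  by rewrite sum_nat_const mulnC leq_mul2l max_card orbT.
have [l [szl lE Ul lF]] := ex e F (subsetUl _ _) cF.
have lL e' z : e' \in S :\ e -> z \in l -> z \in L e' -> False.
  move=> e'S /lF[zF _] zL; case/negP: zF; apply/setUP; right.
  by apply/bigcupP; exists e' => //; rewrite inE.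
exists (fun e' => if e' == e then l else L e'); split=> [e' e'S|e1 e2 z e1S e2S].
  have [->|ne] := eqVneq e' e; last by apply: LP; rewrite in_setD1 ne.
  split=> // z /lF[zF Pz]; split=> //.
  by apply: contraNN zF => zF0; rewrite inE zF0.
have [->|n1] := eqVneq e1 e; have [->|n2] := eqVneq e2 e => //.
- by move=> zl zL; case: (@lL e2 z) => //; rewrite in_setD1 n2.
- by move=> zL zl; case: (@lL e1 z) => //; rewrite in_setD1 n1.
- by apply: Ldis; rewrite in_setD1 ?n1 ?n2.
Qed.

Lemma disjoint_paths_between (T V : finType) (E : rel V) (Out In : T -> {set V}) :
  irreflexive E -> semicomplete E -> 0 < #|T| ->
  (forall v, 40 * #|T| ^ 2 <= #|[set y | E v y]|) ->
  (forall e, 40 * #|T| ^ 2 <= #|Out e|) ->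
  (forall A : {set V}, A != set0 ->
    #|[set w | [exists v in A, E v w]] :\: A| + #|[set k | ~~ [disjoint A & In k]]| <= #|T| ->
    A = setT /\ forall k, ~~ [disjoint A & In k]) ->
  exists p : T -> V * seq V,
    (forall e, [/\ (p e).1 \in Out e, path E (p e).1 (p e).2,
       last (p e).1 (p e).2 \in In e & uniq ((p e).1 :: (p e).2)]) /\
    forall e e' v, v \in (p e).1 :: (p e).2 -> v \in (p e').1 :: (p e').2 -> e = e'.
Proof.
move=> Eirr Esemi T0 Edeg Outdeg conn; set m := #|T| in T0 Edeg Outdeg *.
(* The left side is [3 * (8 * m + 1) + 1 + (8 * m + 1)]. Exits, [B] and earlier links block at most
   [m + 4 * m + 3 * m] vertices, and one vertex of [U] may join them; [U] has [8 * m + 1] elements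
   so that one is unblocked. *)
have big : 32 * m + 5 < 40 * m ^ 2 by rewrite expnS expn1; move: T0; clear; nia.
have [v0 _] : exists v : V, true.
  have /card_gt0P[e _] := T0; have : 0 < #|Out e| by apply: leq_trans (Outdeg e); lia.
  by move=> /card_gt0P[v _]; exists v.
have Vbig : 40 * m ^ 2 <= #|V| by apply: leq_trans (Edeg v0) (max_card _).
have [U [cU Ulink]] : exists U : {set V}, #|U| = (8 * m).+1 /\
    forall u v (F : {set V}), v \in U -> u != v ->
      3 * #|F| + 1 + (8 * m).+1 < 40 * m ^ 2 -> short_link E F u v.
  by apply: exists_sinks => //; lia.
have inU (u : V) : (inr u \in (inr @: U : {set T + V})) = (u \in U).
  by rewrite mem_imset //; exact: inr_inj.
have inrK (v : V) : inr v \notin tokens T V by rewrite in_tokens.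
have GK k : k \in tokens T V -> forall i, token_arc E U In k i = (i \in inr @: U).
  rewrite in_tokens; case: k => // k _ [k'|u] /=; last by rewrite inU.
  by apply/esym/imsetP => -[].
have Gconn := @token_arc_connected T V E U In _ conn.
have Gsemi i j : i \notin tokens T V -> j \notin tokens T V -> i != j ->
    token_arc E U In i j || token_arc E U In j i.
  by case: i j => [k|v] [k'|w]; rewrite !in_tokens //= => _ _ vw; apply: Esemi.
have disj (A : {set V}) : [disjoint inr @: A & tokens T V].
  by apply/pred0Pn => -[i /= /andP[/imsetP[u _ ->]]]; rewrite in_tokens.
have [||||e|s [lev [B [a [fs ainj aP [cB lowfix levarc levU levhigh]]]]]] :=
  @linkage_with_exits _ _ _ _ (token_arc_irr U In Eirr) GK (Gconn _) T
    (fun e => inr @: Out e) Gsemi (disj U).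
- by rewrite cU -/m; move: big; clear; lia.
- by rewrite -card_gt0 card_tokens.
- by rewrite card_tokens.
- by move=> e; apply: disj.
- by rewrite card_tokens card_imset //; exact: inr_inj.
have [x xP] : exists x : T -> V, forall e, x e \in Out e /\ a e = inr (x e).
  apply: (@fin_all_exists _ _ (fun e v => v \in Out e /\ a e = inr v)) => e.
  by have [/imsetP[v vO ->] _ _] := aP e; exists v.
have [p0 [p0P p0dis]] := feasible_paths fs.
pose fixed v := s (inr v) == inr v.
pose h e := (p0 e).1; pose q e := (p0 e).2.
have hmoved e v : v \in h e :: q e -> ~~ fixed v.
  by have [_ _ _ _ mv] := p0P e; exact: mv.
have xfixed e : fixed (x e).
  by rewrite /fixed; have [_ <-] := xP e; have [_ -> _] := aP e.
have xB e : inr (x e) \notin B by have [_ <-] := xP e; have [] := aP e.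
pose B' := [set v | inr v \in B]; pose X := [set x e | e in T].
have cB' : #|B'| <= 4 * m.
  rewrite -(card_imset _ (@inr_inj T V)); rewrite card_tokens in cB.
  apply: leq_trans cB; apply/subset_leq_card/subsetP => _ /imsetP[v vB ->].
  by move: vB; rewrite inE.
(* A route of length at most three from level 2 has its interior at levels up to 4, where vertices
   off [B] are fixed, hence off all paths. *)
have shortlink v (F : {set V}) e : (lev (inr v) <= 2)%R -> v \notin B' -> fixed v -> B' \subset F ->
    3 * #|F| + 1 + (8 * m).+1 < 40 * m ^ 2 ->
    exists l, [/\ size l <= 2, path E v (rcons l (h e)), uniq l &
                  forall z, z \in l -> z \notin F /\ fixed z].
  move=> lv vB fv BF cF.
  have hU : h e \in U by have [] := p0P e.
  have vh : v != h e by apply: contraTneq fv => ->; apply: (hmoved e); rewrite mem_head.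
  have lowB z : z \notin F -> (lev (inr z) <= 4)%R -> fixed z.
    move=> zF z4; apply/eqP; apply: lowfix => //.
    by apply: contraNN zF => zB; apply: (subsetP BF); rewrite inE.
  have step z w i : z \notin B' -> (lev (inr z) <= i)%R -> (i <= 4)%R -> E z w ->
      (lev (inr w) <= i + 1)%R.
    move=> zB zi i4 zw; have := levarc (inr z) (inr w) (inrK z).
    rewrite inE in zB; rewrite zB (le_trans zi i4) => /(_ isT isT zw); move: zi; clear; lia.
  have [vE|[b bF /andP[vb bh]]|[b [c /and5P[bF cF' bc vb /andP[bc' ch]]]]] :=
    Ulink v (h e) F hU vh cF.
  - by exists [::]; rewrite /= vE.
  - exists [:: b]; rewrite /= vb bh; split=> // z; rewrite inE => /eqP->; split=> //.
    by apply: lowB => //; have := step _ _ _ vB lv isT vb; clear; lia.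
  - have b3 := step _ _ _ vB lv isT vb.
    have bB : b \notin B' by apply: contraNN bF; apply: (subsetP BF).
    have c4 := step _ _ _ bB b3 isT bc'.
    exists [:: b; c]; rewrite /= vb bc' ch inE bc; split=> // z; rewrite !inE.
    move=> /orP[/eqP->|/eqP->]; split=> //; apply: lowB => //.
    by move: b3; clear; lia.
have cF0 : #|X :|: B'| <= 5 * m.
  apply: leq_trans (leq_card_setU _ _) _.
  have : #|X| <= m by apply: leq_trans (leq_imset_card _ _) (max_card _).
  by move: cB'; clear; lia.
have [|L [LP Ldis]] := @disjoint_links T V E (X :|: B') fixed x h 3 0.
  move=> e F XF cF.
  have cF8 : #|F| <= 8 * m by move: cF cF0; rewrite -/m; clear; lia.
  have BF : B' \subset F by apply: subset_trans (subsetUr _ _) XF.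
  have xF : x e \in F by apply: (subsetP XF); rewrite inE imset_f.
  have [x2|x3] := leP (lev (inr (x e))) 2%R.
    have [||||l [sl lE Ul lF]] := @shortlink (x e) F e x2 => //.
    - by rewrite inE.
    - by move: cF8 big; clear; lia.
    by exists l; split=> //; apply: leq_trans sl _.
  (* A high exit dominates every unblocked [u] in [U]; going through [u] first makes at most three
     interior vertices. *)
  have [u uU uF] : exists2 u, u \in U & u \notin F.
    have : 0 < #|U :\: F|.
      rewrite cardsD cU; have := subset_leq_card (subsetIr U F); move: cF8; clear; lia.
    by move=> /card_gt0P[u /setDP[]]; exists u.
  have uB : inr u \notin B by apply: contraNN uF => uB; apply: (subsetP BF); rewrite inE.
  have u1 : (lev (inr u) <= 1)%R by apply: levU; rewrite inU.
  have xu : E (x e) u.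
    have ne : inr (x e) != inr u :> T + V by apply: contraNneq uF => -[<-].
    have x3' : (3 <= lev (inr (x e)))%R by move: x3; clear; lia.
    by have := levhigh (inr u) (inr (x e)); rewrite inU; apply.
  have [|||||l [sl lE Ul lF]] := @shortlink u (u |: F) e.
  - by move: u1; clear; lia.
  - by rewrite inE.
  - by apply/eqP/lowfix => //; move: u1; clear; lia.
  - exact: subset_trans BF (subsetUr _ _).
  - by rewrite cardsU1 uF; move: cF8 big; clear; lia.
  exists (u :: l); rewrite /= xu lE; split=> //.
    by rewrite Ul andbT; apply/negP => /lF[]; rewrite in_setU1 eqxx.
  move=> z; rewrite inE => /predU1P[->|/lF[zF fz]]; last first.
    by split=> //; apply: contraNN zF => zF; rewrite inE zF orbT.
  by split=> //; apply/eqP/lowfix => //; move: u1; clear; lia.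
have XLP e e' : x e \notin L e'.
  have [_ _ LF] := LP e'; apply/negP => /LF[]; rewrite inE imset_f //.
have Lfix e z : z \in L e -> fixed z by have [_ _ LF] := LP e; move=> /LF[].
exists (fun e => (x e, L e ++ h e :: q e)); split=> [e|e e' v] /=.
  have [hU pE lI Up _] := p0P e; have [LE UL _] := LP e.
  split.
  - by have [] := xP e.
  - by rewrite -cat_rcons cat_path last_rcons LE.
  - by rewrite last_cat /=.
  - rewrite mem_cat negb_or XLP /= cat_uniq UL; apply/andP; split.
      by apply: contraTN (xfixed e); apply: hmoved.
    apply/and3P; split=> //.
    by apply/hasPn => z /hmoved; apply: contraNN => /Lfix.
have xinj : injective x.
  by move=> e1 e2 e12; apply: ainj; have [_ ->] := xP e1; have [_ ->] := xP e2; rewrite e12.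
rewrite !(in_cons (x _)) !mem_cat.
case/or3P=> [/eqP->|vL|vh]; case/or3P=> [/eqP|vL'|vh'].
- exact: xinj.
- by move: vL'; rewrite (negPf (XLP _ _)).
- by have := hmoved _ _ vh'; rewrite xfixed.
- by move=> vx; move: vL; rewrite vx (negPf (XLP _ _)).
- exact: Ldis vL vL'.
- by have := hmoved _ _ vh'; rewrite (Lfix _ _ vL).
- by move=> vx; have := hmoved _ _ vh; rewrite vx xfixed.
- by have := hmoved _ _ vh; rewrite (Lfix _ _ vL').
- exact: p0dis vh vh'.
Qed.

(** * Reduction to the complement of the terminals *)

Section Reduction.
Variables (VH VD : finType) (EH : rel VH) (ED : rel VD) (f : VH -> VD).
Hypothesis f_inj : injective f.

Let W : {set VD} := [set f v | v in VH].
Let T := {p : VH * VH | EH p.1 p.2}.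
Let V := {x : VD | x \notin W}.
Let ends (k : T) : {set V} := [set y | ED (val y) (f (val k).2)].

Lemma card_arcs : #|{: {p : VH * VH | EH p.1 p.2}}| = narcs EH.
Proof. by rewrite card_sig /narcs cardsE. Qed.

Lemma f_notin_V v (x : V) : val x != f v.
Proof. by apply: contraNneq (valP x) => /= ->; rewrite imset_f. Qed.

(** [F] collects the images of sources, the boundary of [A] and the heads reached from [A]: at most
    [k_1 + m] vertices. A walk from [A] avoiding [F] cannot leave [A], so by connectivity all
    vertices off [F] lie in [A]. *)
Lemma connected_off_terminals :
  t_connected ED (nsources EH + narcs EH + 1) ->
  forall A : {set V}, A != set0 ->
    #|[set w | [exists v in A, ED (val v) (val w)]] :\: A|
      + #|[set k | ~~ [disjoint A & ends k]]| <= #|{: T}| ->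
    A = setT /\ forall k, ~~ [disjoint A & ends k].
Proof.
move=> [_ conn] A /set0Pn[a aA].
set S := _ :\: A; set H := [set k | _]; rewrite card_arcs => cSH.
pose head (k : T) := f (val k).2.
pose F := [set f v | v in [set v | indeg EH v == 0]] :|: val @: S :|: head @: H.
have cF : #|F| < nsources EH + narcs EH + 1.
  rewrite addn1 ltnS; apply: leq_trans (leq_card_setU _ _) _.
  apply: (@leq_trans (nsources EH + #|S| + #|H|)); last by rewrite -addnA leq_add2l.
  apply: leq_add (leq_imset_card _ _); apply: leq_trans (leq_card_setU _ _) _.
  exact: leq_add (leq_imset_card _ _) (leq_imset_card _ _).
have headH (x : V) k : x \in A -> ED (val x) (head k) -> k \in H.
  by move=> xA xk; rewrite inE; apply/pred0Pn; exists x; rewrite /= xA inE.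
have walk s (x : V) : x \in A -> path ED (val x) s -> all (fun z => z \notin F) s ->
    exists2 y : V, y \in A & last (val x) s = val y.
  elim: s x => [|z s IH] x xA /=; first by exists x.
  move=> /andP[xz zs] /andP[zF sF]; have [zW|zW] := boolP (z \in W).
    case/negP: zF; case/imsetP: zW xz => v _ -> xv.
    have [v0|] := eqVneq (indeg EH v) 0.
      by rewrite !in_setU imset_f ?inE ?v0.
    rewrite -lt0n => /card_gt0P[u]; rewrite inE => uv.
    have := headH x (exist _ (u, v) uv) xA xv => kH.
    by rewrite in_setU; apply/orP; right; apply/imsetP; exists (exist _ (u, v) uv).
  pose z' : V := exist _ z zW; apply: (IH z') => //.
  apply/negPn/negP => z'A; case/negP: zF; rewrite !in_setU; apply/orP; left; apply/orP; right.
  apply/imsetP; exists z' => //; rewrite in_setD z'A inE; apply/exists_inP; by exists x.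
have valF (x : V) : (val x \in F) = (x \in S).
  rewrite !in_setU (mem_imset _ _ val_inj); apply/idP/idP => [|->]; last by rewrite orbT.
  case/orP => [/orP[/imsetP[v _ e]|//]|/imsetP[k _ e]].
    by have := f_notin_V v x; rewrite e eqxx.
  by have := f_notin_V (val k).2 x; rewrite e eqxx.
have aF : val a \notin F by rewrite valF in_setD aA.
have reach w : w \notin F -> exists2 y : V, y \in A & w = val y.
  move=> wF; have [->|ne] := eqVneq w (val a); first by exists a.
  rewrite eq_sym in ne; have [s /andP[/andP[ps _] sF]] := conn F cF _ _ aF wF ne.
  have [|y yA ey] := walk _ a aA ps; first by rewrite all_rcons wF.
  by exists y => //; rewrite -ey last_rcons.
(* A head is a terminal, so it lies in [F]; having an in-arc it is no source image, so it is reached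
   from [A]. All [m] arcs are then counted in [H], which leaves no room for [S]. *)
have allH k : k \in H.
  have kF : head k \in F.
    apply/negPn/negP => /reach[y _ ey]; have := f_notin_V (val k).2 y.
    by rewrite -ey eqxx.
  move: kF; rewrite !in_setU => /orP[/orP[/imsetP[v]|/imsetP[y _ ey]]|/imsetP[k' k'H ek]].
  - rewrite inE => /eqP v0 /f_inj ev; have : (val k).1 \in [set u | EH u v].
      by rewrite inE -ev; exact: valP k.
    by move: v0; rewrite /indeg => /cards0_eq ->; rewrite inE.
  - by have := f_notin_V (val k).2 y; rewrite -ey eqxx.
  - move: k'H; rewrite !inE => /pred0Pn[x /= /andP[xA]]; rewrite inE -/(head k') -ek => xk.
    by apply/pred0Pn; exists x; rewrite /= xA inE.
have S0 : S = set0.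
  apply/eqP; rewrite -cards_eq0; move: cSH.
  have -> : H = setT by apply/setP => k; rewrite allH inE.
  by rewrite cardsT card_arcs -[X in _ <= X -> _]add0n leq_add2r leqn0.
split=> [|k]; last by have := allH k; rewrite inE.
apply/setP => x; rewrite in_setT.
by have [|y yA /val_inj ->] := reach (val x); first by rewrite valF S0 inE.
Qed.

Lemma card_out_off_terminals x :
  outdeg ED x <= #|[set y : V | ED x (val y)]| + #|VH|.
Proof.
rewrite -(card_imset _ val_inj) -(card_imset VH f_inj).
apply: leq_trans (leq_card_setU _ _); apply/subset_leq_card/subsetP => y.
rewrite !inE => xy; have [//|yW] := boolP (y \in [set f v | v in VH]); first by rewrite orbT.
by rewrite orbF; apply/imsetP; exists (exist _ y yW); rewrite ?inE.
Qed.

Lemma linked_of_disjoint_paths (p : T -> V * seq V) :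
  irreflexive EH ->
  (forall e, [/\ (p e).1 \in [set y : V | ED (f (val e).1) (val y)],
      path (fun v w : V => ED (val v) (val w)) (p e).1 (p e).2,
      last (p e).1 (p e).2 \in ends e & uniq ((p e).1 :: (p e).2)]) ->
  (forall e e' v, v \in (p e).1 :: (p e).2 -> v \in (p e').1 :: (p e').2 -> e = e') ->
  exists g, is_subdivision EH ED f g.
Proof.
move=> Hirr pP pdis.
pose r e := map val ((p e).1 :: (p e).2).
(* Pairs that are not arcs get the empty sequence. *)
exists (fun u v => if insub (u, v) is Some e then r e else [::]).
have gE u v (uv : EH u v) : (if insub (u, v) is Some e then r e else [::]) = r (exist _ (u, v) uv).
  by rewrite (insubT (fun q : VH * VH => EH q.1 q.2) (uv : EH (u, v).1 (u, v).2)).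
have notin v (s : seq V) : f v \notin map val s.
  by apply/mapP => -[x _ e]; have := f_notin_V v x; rewrite e eqxx.
split=> //.
- move=> u v uv.
  have fuv : f u != f v by rewrite (inj_eq f_inj); apply: contraTneq uv => ->; rewrite Hirr.
  rewrite gE; set e := exist _ _ _; rewrite /r.
  have [p1 pp pl pu] := pP e.
  rewrite /dipath rcons_path; apply/andP; split.
    rewrite /= path_map last_map; rewrite inE in p1; rewrite inE in pl.
    by rewrite p1 pp pl.
  rewrite cons_uniq rcons_uniq mem_rcons inE negb_or fuv !notin.
  by rewrite (map_inj_uniq val_inj).
- move=> u v u' v' uv u'v' ne; rewrite !gE.
  rewrite disjoint_has; apply/hasPn => _ /mapP[x xe ->].
  rewrite /= (mem_map val_inj (_ :: _)); apply/negP => xe'.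
  by have /(congr1 val) /= ee := pdis _ _ x xe xe'; rewrite ee eqxx in ne.
- by move=> u v w uv; rewrite gE; apply: (notin w (_ :: _)).
Qed.
End Reduction.

(** * Degree arithmetic and conclusion *)

Lemma card_le_arcs (VH : finType) (EH : rel VH) :
  (forall v, 0 < outdeg EH v + indeg EH v) -> #|VH| <= 2 * narcs EH.
Proof.
move=> EHpos; rewrite mul2n -addnn.
pose A := [set p : VH * VH | EH p.1 p.2].
apply: (@leq_trans #|fst @: A :|: snd @: A|).
  apply/subset_leq_card/subsetP => v _; have := EHpos v; rewrite addn_gt0.
  case/orP=> /card_gt0P[u]; rewrite inE => uv; rewrite in_setU.
    by rewrite (imset_f fst (_ : (v, u) \in A)) ?inE.
  by rewrite (imset_f snd (_ : (u, v) \in A)) ?inE ?orbT.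
apply: leq_trans (leq_card_setU _ _) _.
exact: leq_add (leq_imset_card _ _) (leq_imset_card _ _).
Qed.

Lemma narcs_le_qparam (VH : finType) (EH : rel VH) :
  0 < narcs EH -> ((narcs EH)%:R <= qparam EH)%R.
Proof.
move=> /card_gt0P[[u v]]; rewrite inE /= => uv.
have D1 : 0 < maxoutdeg EH.
  apply: leq_trans (leq_bigmax u); apply/card_gt0P; by exists v; rewrite inE.
have m0 : (0 <= (narcs EH)%:R :> rat)%R by apply: ler0n.
have D1r : (1 <= (maxoutdeg EH)%:R :> rat)%R by rewrite ler1n.
rewrite /qparam -{1}[((narcs EH)%:R)%R]mul1r; apply: ler_pM => //.
by rewrite le_max lexx orbT.
Qed.

Theorem theorem5 (VH VD : finType) (EH : rel VH) (ED : rel VD) :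
  irreflexive EH ->
  (forall v : VH, 0 < outdeg EH v + indeg EH v) ->
  irreflexive ED ->
  semicomplete ED ->
  t_connected ED (nsources EH + narcs EH + 1) ->
  (forall x : VD, ((10 : rat) ^+ 7 * qparam EH ^+ 4 <= (outdeg ED x)%:R)%R) ->
  H_linked EH ED.
Proof.
move=> Hirr Hpos Dirr Dsemi Dconn Ddeg f f_inj.
have [m0|m_gt0] := posnP (narcs EH).
  exists (fun _ _ => [::]).
  have noarc u v : EH u v = false.
    apply/negP => uv; have : (u, v) \in [set p : VH * VH | EH p.1 p.2] by rewrite inE.
    by rewrite (cards0_eq m0) inE.
  by split=> // [u v|u v u' v']; rewrite noarc.
have deg x : 40 * narcs EH ^ 2 + #|VH| <= outdeg ED x.
  (* With [m >= 1], the bound [h <= 2 * m] gives [40 * m ^ 2 + h <= 42 * m ^ 4], and [m <= q]. *)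
  apply: (@leq_trans (42 * narcs EH ^ 4)).
    have := card_le_arcs Hpos; move: (#|VH|) (narcs EH) m_gt0 => h m m1 hm.
    have : m <= m ^ 2 by rewrite -{1}[m]expn1 leq_pexp2l.
    have : m ^ 2 <= m ^ 4 by rewrite leq_pexp2l.
    lia.
  rewrite -(ler_nat rat); apply: le_trans (Ddeg x).
  have q0 : (0 <= qparam EH)%R by apply: le_trans (narcs_le_qparam m_gt0); exact: ler0n.
  rewrite natrM natrX; apply: ler_pM; [exact: ler0n | exact: exprn_ge0 (ler0n _ _) | |].
    rewrite (exprD _ 2 5); apply: (@le_trans _ _ (10 ^+ 2)%R).
      by rewrite -natrX ler_nat.
    by apply: ler_peMr; [apply: exprn_ge0 | apply: exprn_ege1]; rewrite ?ler0n ?ler1n.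
  by apply: lerXn2r; rewrite ?nnegrE ?ler0n ?narcs_le_qparam.
pose T := {p : VH * VH | EH p.1 p.2}.
pose V := {x : VD | x \notin [set f v | v in VH]}.
have degV x : 40 * #|{: T}| ^ 2 <= #|[set y : V | ED x (val y)]|.
  rewrite (card_arcs EH) -(leq_add2r #|VH|).
  exact: leq_trans (deg x) (card_out_off_terminals ED f_inj x).
have [||||||p [pP pdis]] := @disjoint_paths_between T V (fun v w => ED (val v) (val w))
  (fun e => [set y | ED (f (val e).1) (val y)]) (fun e => [set y | ED (val y) (f (val e).2)]).
- by move=> v; apply: Dirr.
- by move=> v w vw; apply: Dsemi; rewrite (inj_eq val_inj).
- by rewrite (card_arcs EH).
- by move=> v; apply: degV.
- by move=> e; apply: degV.
- exact: connected_off_terminals.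
exact: linked_of_disjoint_paths pP pdis.
Qed.
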